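(* Let $(\phi^n,\psi^n,U^n,\boldsymbol{u}^n,p^n)_{n\ge 0}$ and $(\widetilde{\boldsymbol u}^{n+1})_{n\ge1}$ be generated by the BDF2 (Adams-Bashforth) scheme described in the context. Then, for every time step $\delta t>0$ (unconditionally) and every $n\ge1$, the following discrete energy dissipation law holds: $$E^{n+1}\le E^{n}-\frac{\delta t}{M}\|\dot\phi^{n+1}\|^2-\delta t\Big(\mu_1\|(\nabla\phi^{*,n+1})^TD(\widetilde{\boldsymbol u}^{n+1})\nabla\phi^{*,n+1}\|^2+\mu_4\|D(\widetilde{\boldsymbol u}^{n+1})\|^2+\mu_5\|D(\widetilde{\boldsymbol u}^{n+1})\nabla\phi^{*,n+1}\|^2\Big),$$ where, for $n\ge 0$, $$E^{n+1}=\frac12\Big(\frac{\|\boldsymbol u^{n+1}\|^2}{2}+\frac{\|2\boldsymbol u^{n+1}-\boldsymbol u^n\|^2}{2}\Big)+\frac K2\Big(\frac{\|\psi^{n+1}\|^2}{2}+\frac{\|2\psi^{n+1}-\psi^n\|^2}{2}\Big)+\frac{K}{4\epsilon^2}\Big(\frac{\|U^{n+1}\|^2}{2}+\frac{\|2U^{n+1}-U^n\|^2}{2}\Big)+\frac{\delta t^2}{3}\|\nabla p^{n+1}\|^2 .$$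
   Context: $\Omega\subset\mathbb{R}^d$, $d\in\{2,3\}$, is a bounded domain with smooth boundary and outward normal $\boldsymbol m$; $\|\cdot\|$ is the $L^2(\Omega)$ norm (of scalar, vector or matrix fields). The constants satisfy $K,M,\epsilon>0$ and $\mu_1,\mu_4,\mu_5\ge0$; $\delta t>0$ is the time step. Notation: $D(\boldsymbol{u})=\frac12(\nabla\boldsymbol{u}+\nabla\boldsymbol{u}^T)$, $B(\boldsymbol{u},\boldsymbol{v})=(\boldsymbol{u}\cdot\nabla)\boldsymbol{v}+\frac12(\nabla\cdot\boldsymbol{u})\boldsymbol{v}$, and $$\sigma(\boldsymbol{u},\phi)=\mu_1\big(\nabla\phi^TD(\boldsymbol{u})\nabla\phi\big)\nabla\phi\otimes\nabla\phi+\mu_4D(\boldsymbol{u})+\mu_5\big(D(\boldsymbol{u})\nabla\phi\otimes\nabla\phi+\nabla\phi\otimes D(\boldsymbol{u})\nabla\phi\big).$$ BDF2 scheme. The values $(\phi^j,\psi^j,U^j,\boldsymbol u^j,p^j)$, $j=0,1$, are given, with $\psi^j=-\Delta\phi^j$, $\partial_{\boldsymbol m}\phi^j=\partial_{\boldsymbol m}\psi^j=0$ on $\partial\Omega$, $\nabla\cdot\boldsymbol u^j=0$ in $\Omega$ and $\boldsymbol u^j\cdot\boldsymbol m=0$ on $\partial\Omega$. For $n\ge1$ set $$\boldsymbol u^{*,n+1}=2\boldsymbol u^n-\boldsymbol u^{n-1},\quad \phi^{*,n+1}=2\phi^n-\phi^{n-1},\quad \dot\phi^{n+1}=\frac{3\phi^{n+1}-4\phi^n+\phi^{n-1}}{2\delta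 t}+\nabla\cdot(\widetilde{\boldsymbol u}^{n+1}\phi^{*,n+1}).$$ Step 1: find $\phi^{n+1},\psi^{n+1},U^{n+1},\widetilde{\boldsymbol u}^{n+1}$ with $$\frac1M\dot\phi^{n+1}=K\Delta\psi^{n+1}+\frac K{\epsilon^2}\nabla\cdot(U^{n+1}\nabla\phi^{*,n+1}),\qquad \psi^{n+1}=-\Delta\phi^{n+1},$$ $$3U^{n+1}-4U^n+U^{n-1}=2\nabla\phi^{*,n+1}\cdot(3\nabla\phi^{n+1}-4\nabla\phi^n+\nabla\phi^{n-1}),$$ $$\frac{3\widetilde{\boldsymbol u}^{n+1}-4\boldsymbol u^n+\boldsymbol u^{n-1}}{2\delta t}+B(\boldsymbol u^{*,n+1},\widetilde{\boldsymbol u}^{n+1})-\nabla\cdot\sigma(\widetilde{\boldsymbol u}^{n+1},\phi^{*,n+1})+\nabla p^n-\frac1M\phi^{*,n+1}\nabla\dot\phi^{n+1}=0,$$ and $\widetilde{\boldsymbol u}^{n+1}=0$, $\partial_{\boldsymbol m}\phi^{n+1}=\partial_{\boldsymbol m}\psi^{n+1}=0$ on $\partial\Omega$. Step 2: find $\boldsymbol u^{n+1},p^{n+1}$ with $$3\,\frac{\boldsymbol u^{n+1}-\widetilde{\boldsymbol u}^{n+1}}{2\delta t}+\nabla(p^{n+1}-p^n)=0,\qquad \nabla\cdot\boldsymbol u^{n+1}=0,\qquad \boldsymbol u^{n+1}\cdot\boldsymbol m|_{\partial\Omega}=0.$$ All functions are assumed smooth on $\overline\Omega$, so that the equations hold pointwise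 and all integrations by parts are justified. *)

(* Defs.v *)
From HB Require Import structures.
From mathcomp Require Import all_boot all_order all_algebra.
From mathcomp Require Import all_classical all_reals all_analysis.

Set Implicit Arguments.
Unset Strict Implicit.
Unset Printing Implicit Defensive.

Import Order.TTheory GRing.Theory Num.Theory.
Import numFieldNormedType.Exports.

Local Open Scope classical_set_scope.
Local Open Scope ring_scope.

(* Points of R^d are row vectors 'rV[R]_d (the form used by the Heine-Borel and
   extreme value theorems of the library). Values of vector fields are column
   vectors 'cV[R]_d, so that a^T *m A *m b and a *m b^T are the usual a^T A b
   and the tensor product of a and b. *)

Section lebesgue_measure_Rd.
Context {R : realType}.

Local Notation mR := (measurableTypeR R).

Definition tcons n (z : mR * n.-tuple mR) : n.+1.-tuple mR :=
  [the n.+1.-tuple mR of z.1 :: z.2].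

(* d-fold product of the one-dimensional Lebesgue measure. *)
Fixpoint lebesgue_Rd (d : nat) : set (d.-tuple mR) -> \bar R :=
  match d with
  | 0 => \d_ [tuple]
  | n.+1 => pushforward ((@lebesgue_measure R) \x (@lebesgue_Rd n))%E
              (@tcons n)
  end.

Arguments lebesgue_Rd : clear implicits.

Lemma measurable_tcons n : measurable_fun setT (@tcons n).
Proof. exact: measurable_cons. Qed.

Lemma lebesgue_Rd_sigma_finite_measure d :
  exists m : {sigma_finite_measure set (d.-tuple mR) -> \bar R},
    lebesgue_Rd d = m.
Proof.
elim: d => [|d [m mE]].
  by exists (\d_ ([tuple] : 0.-tuple mR) :
    {sigma_finite_measure set _ -> \bar R}).
rewrite /= mE.
pose l : {sigma_finite_measure set mR -> \bar R} := @lebesgue_measure R.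
pose p := [the {measure set _ -> \bar R} of (l \x m)%E].
pose q0 := [the {measure set _ -> \bar R} of pushforward p (@tcons d)].
pose q := q0 (@measurable_tcons d).
have sq : sigma_finite setT q.
  have sp : sigma_finite setT p.
    have /sigma_finiteP[F [TF ndF Foo]] := sigma_finiteT l.
    have /sigma_finiteP[G [TG ndG Goo]] := sigma_finiteT m.
    exists (fun n => F n `*` G n).
      rewrite -setXTT TF TG predeqE => -[x y]; split; last first.
        by move=> [n _ []/= ? ?]; split; exists n.
      move=> [/= [n _ Fnx] [k _ Gky]]; exists (maxn n k) => //; split.
      - by move: x Fnx; exact/subsetPset/ndF/leq_maxl.
      - by move: y Gky; exact/subsetPset/ndG/leq_maxr.
    move=> k; have [? ?] := Foo k; have [? ?] := Goo k.
    split; first exact: measurableX.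
    by rewrite [p _]product_measure1E// lte_mul_pinfty// ge0_fin_numE.
  have [F FT Foo] := sp.
  pose g (t : d.+1.-tuple mR) : (mR * d.-tuple mR)%type :=
    (tnth t ord0, [tuple of behead t]).
  have mg : measurable_fun setT g.
    apply: measurable_fun_pair; first exact: measurable_tnth.
    exact: measurable_behead.
  have gK : cancel (@tcons d) g.
    by case=> x t; rewrite /g /tcons /= (tnth_nth x)/=; congr pair; exact: val_inj.
  exists (fun n => g @^-1` F n).
    by rewrite -preimage_bigcup -FT preimage_setT.
  move=> n; have [mF Fn] := Foo n; split.
    by rewrite -[X in measurable X]setTI; exact: mg.
  rewrite /q /= /pushforward -comp_preimage.
  by rewrite (_ : g \o @tcons d = id) ?preimage_id//; apply/funext => z /=.
pose H := Measure_isSigmaFinite.Build _ _ _ q sq.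
pose q' : {sigma_finite_measure set (d.+1.-tuple mR) -> \bar R} :=
  HB.pack (q : set _ -> \bar R) (Measure.class q) H.
by exists q'.
Qed.

Let lebesgue_Rd0 d : lebesgue_Rd d set0 = 0%E.
Proof. by have [m ->] := lebesgue_Rd_sigma_finite_measure d; exact: measure0. Qed.

Let lebesgue_Rd_ge0 d A : (0 <= lebesgue_Rd d A)%E.
Proof.
by have [m ->] := lebesgue_Rd_sigma_finite_measure d; exact: measure_ge0.
Qed.

Let lebesgue_Rd_sigma_additive d : semi_sigma_additive (lebesgue_Rd d).
Proof.
have [m ->] := lebesgue_Rd_sigma_finite_measure d.
exact: measure_semi_sigma_additive.
Qed.

HB.instance Definition _ d := isMeasure.Build _ _ _ (lebesgue_Rd d)
  (lebesgue_Rd0 d) (@lebesgue_Rd_ge0 d) (@lebesgue_Rd_sigma_additive d).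

Let lebesgue_Rd_sigma_finite d : sigma_finite setT (lebesgue_Rd d).
Proof.
have [m ->] := lebesgue_Rd_sigma_finite_measure d; exact: sigma_finiteT.
Qed.

HB.instance Definition _ d := Measure_isSigmaFinite.Build _ _ _
  (lebesgue_Rd d) (lebesgue_Rd_sigma_finite d).

End lebesgue_measure_Rd.
Arguments lebesgue_Rd {R} d _.

Section fields.
Context {R : realType} {d : nat}.
Implicit Types (Omega V : set 'rV[R]_d) (f rho : 'rV[R]_d -> R)
  (u v : 'rV[R]_d -> 'cV[R]_d) (S : 'rV[R]_d -> 'M[R]_d).

Definition partial (i : 'I_d) f : 'rV[R]_d -> R :=
  fun x => 'D_(delta_mx 0 i) f x.

Definition grad f : 'rV[R]_d -> 'cV[R]_d := fun x => \col_i partial i f x.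

Definition gradv u : 'rV[R]_d -> 'M[R]_d :=
  fun x => \matrix_(i, j) partial j (fun y => u y i 0) x.

Definition div u : 'rV[R]_d -> R :=
  fun x => \sum_i partial i (fun y => u y i 0) x.

Definition divm S : 'rV[R]_d -> 'cV[R]_d :=
  fun x => \col_i \sum_j partial j (fun y => S y i j) x.

Definition laplacian f : 'rV[R]_d -> R := div (grad f).

Definition symgrad u : 'rV[R]_d -> 'M[R]_d :=
  fun x => 2^-1 *: (gradv u x + (gradv u x)^T).

(* gradv v x *m u x is (u . grad) v *)
Definition Bform u v : 'rV[R]_d -> 'cV[R]_d :=
  fun x => gradv v x *m u x + (2^-1 * div u x) *: v x.

Definition quadform (A : 'M[R]_d) (g : 'cV[R]_d) : R := (g^T *m A *m g) 0 0.

Definition dotv (a b : 'cV[R]_d) : R := (a^T *m b) 0 0.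

Definition stress (mu1 mu4 mu5 : R) u f : 'rV[R]_d -> 'M[R]_d := fun x =>
  let g := grad f x in let D := symgrad u x in
  (mu1 * quadform D g) *: (g *m g^T) + mu4 *: D
  + mu5 *: ((D *m g) *m g^T + g *m (D *m g)^T).

(* C^k on the open set V. For k > 0 this asks for a Frechet derivative whose
   coordinates (the partial derivatives) are C^(k-1). *)
Fixpoint Ck_on (k : nat) V f : Prop :=
  match k with
  | 0 => forall x, V x -> {for x, continuous f}
  | k'.+1 => (forall x, V x -> differentiable f x) /\
             (forall i, Ck_on k' V (partial i f))
  end.

Definition smooth_on V f := forall k, Ck_on k V f.

(* f is smooth up to the boundary of Omega: it is smooth on an open
   neighbourhood of the closure, so that the boundary values of f and of its
   derivatives are those of the extension by continuity from Omega. *)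
Definition smooth_bar Omega f :=
  exists V, [/\ open V, closure Omega `<=` V & smooth_on V f].

Definition smooth_barv Omega u :=
  forall i, smooth_bar Omega (fun x => u x i 0).

Definition bdry Omega := closure Omega `\` interior Omega.

(* Frobenius norm: the Euclidean norm for column vectors (the norm `|A| of the
   library is the maximum norm). *)
Definition frob m n (A : 'M[R]_(m, n)) : R :=
  Num.sqrt (\sum_i \sum_j (A i j) ^+ 2).

Definition defining_function Omega V rho :=
  [/\ open V, smooth_on V rho, (forall x, V x -> grad rho x != 0) &
      (forall x, V x -> (Omega x <-> rho x < 0))].

Definition bounded_smooth_domain Omega :=
  [/\ open Omega, connected Omega, Omega !=set0, bounded_set Omega &
      (forall x, bdry Omega x ->
        exists V rho, V x /\ defining_function Omega V rho)].

(* The value does not depend on the defining function chosen near x. *)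
Definition outward_normal Omega (m : 'rV[R]_d -> 'cV[R]_d) :=
  forall x V rho, bdry Omega x -> V x -> defining_function Omega V rho ->
    m x = (frob (grad rho x))^-1 *: grad rho x.

Definition row_of_tuple (t : d.-tuple (measurableTypeR R)) : 'rV[R]_d :=
  \row_i tnth t i.

Definition L2norm Omega f : R :=
  Num.sqrt (\int[lebesgue_Rd d]_(t in row_of_tuple @^-1` Omega)
              (f (row_of_tuple t)) ^+ 2).

Definition L2normM Omega m n (F : 'rV[R]_d -> 'M[R]_(m, n)) : R :=
  L2norm Omega (fun x => frob (F x)).

End fields.

Section time_stencils.
Context {T : Type} {V : zmodType}.
Implicit Type v : nat -> T -> V.

(* v^{*,n+1}, for n >= 1 *)
Definition extrap v (n : nat) : T -> V := fun x => v n x *+ 2 - v n.-1 x.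

(* 3 v^{n+1} - 4 v^n + v^{n-1}, for n >= 1 *)
Definition bdf v (n : nat) : T -> V :=
  fun x => v n.+1 x *+ 3 - v n x *+ 4 + v n.-1 x.

End time_stencils.

Section scheme.
Context {R : realType} {d : nat}.
Variables (K M eps mu1 mu4 mu5 dt : R).
Variables (Omega : set 'rV[R]_d) (m : 'rV[R]_d -> 'cV[R]_d).
Variables (phi psi U : nat -> 'rV[R]_d -> R) (u : nat -> 'rV[R]_d -> 'cV[R]_d)
  (p : nat -> 'rV[R]_d -> R) (ut : nat -> 'rV[R]_d -> 'cV[R]_d).

(* \dot\phi^{n+1}, for n >= 1; ut n.+1 is \widetilde u^{n+1} *)
Definition phidot (n : nat) : 'rV[R]_d -> R := fun x =>
  bdf phi n x / (2 * dt) + div (fun y => extrap phi n y *: ut n.+1 y) x.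

Definition neumann (f : 'rV[R]_d -> R) :=
  forall x, bdry Omega x -> dotv (grad f x) (m x) = 0.

Definition no_flux (v : 'rV[R]_d -> 'cV[R]_d) :=
  forall x, bdry Omega x -> dotv (v x) (m x) = 0.

Definition initial_data (j : nat) :=
  [/\ (forall x, Omega x -> psi j x = - laplacian (phi j) x),
      neumann (phi j), neumann (psi j),
      (forall x, Omega x -> div (u j) x = 0) & no_flux (u j)].

Record step1 (n : nat) : Prop := {
  step1_phi : forall x, Omega x ->
    M^-1 * phidot n x = K * laplacian (psi n.+1) x
      + K / eps ^+ 2 * div (fun y => U n.+1 y *: grad (extrap phi n) y) x ;
  step1_psi : forall x, Omega x -> psi n.+1 x = - laplacian (phi n.+1) x ;
  step1_U : forall x, Omega x ->
    bdf U n x = 2 * dotv (grad (extrap phi n) x)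
                         (bdf (fun j => grad (phi j)) n x) ;
  step1_ut : forall x, Omega x ->
    (2 * dt)^-1 *: (ut n.+1 x *+ 3 - u n x *+ 4 + u n.-1 x)
      + Bform (extrap u n) (ut n.+1) x
      - divm (stress mu1 mu4 mu5 (ut n.+1) (extrap phi n)) x
      + grad (p n) x
      - (M^-1 * extrap phi n x) *: grad (phidot n) x = 0 ;
  step1_ut_bdry : forall x, bdry Omega x -> ut n.+1 x = 0 ;
  step1_phi_bdry : neumann (phi n.+1) ;
  step1_psi_bdry : neumann (psi n.+1)
}.

Record step2 (n : nat) : Prop := {
  step2_u : forall x, Omega x ->
    (3 / (2 * dt)) *: (u n.+1 x - ut n.+1 x)
      + grad (fun y => p n.+1 y - p n y) x = 0 ;
  step2_div : forall x, Omega x -> div (u n.+1) x = 0 ;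
  step2_bdry : no_flux (u n.+1)
}.

Record bdf2_scheme : Prop := {
  bdf2_smooth : forall j, [/\ smooth_bar Omega (phi j),
    smooth_bar Omega (psi j), smooth_bar Omega (U j),
    smooth_barv Omega (u j) & smooth_bar Omega (p j)] ;
  bdf2_smooth_ut : forall n, (1 <= n)%N -> smooth_barv Omega (ut n.+1) ;
  bdf2_init0 : initial_data 0 ;
  bdf2_init1 : initial_data 1 ;
  bdf2_step1 : forall n, (1 <= n)%N -> step1 n ;
  bdf2_step2 : forall n, (1 <= n)%N -> step2 n
}.

(* E^n, for n >= 1 *)
Definition energy (n : nat) : R :=
  2^-1 * (L2normM Omega (u n) ^+ 2 / 2
          + L2normM Omega (fun x => 2 *: u n x - u n.-1 x) ^+ 2 / 2)
  + K / 2 * (L2norm Omega (psi n) ^+ 2 / 2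
             + L2norm Omega (fun x => 2 * psi n x - psi n.-1 x) ^+ 2 / 2)
  + K / (4 * eps ^+ 2) * (L2norm Omega (U n) ^+ 2 / 2
             + L2norm Omega (fun x => 2 * U n x - U n.-1 x) ^+ 2 / 2)
  + dt ^+ 2 / 3 * L2normM Omega (grad (p n)) ^+ 2.

End scheme.

(* Main.v *)
Require Import Defs.
From HB Require Import structures.
From mathcomp Require Import all_boot all_order all_algebra.
From mathcomp Require Import all_classical all_reals all_analysis.
From mathcomp Require Import measurable_realfun ring lra.

Set Implicit Arguments.
Unset Strict Implicit.
Unset Printing Implicit Defensive.

Import Order.TTheory GRing.Theory Num.Theory.
Import numFieldNormedType.Exports.

Local Open Scope classical_set_scope.
Local Open Scope ring_scope.

(** The law is the integral over the domain of a pointwise identity,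
    [bdf2_energy_identity]: the increment of the energy density plus the
    dissipation density is a linear combination of divergences minus a sum of
    squares.  To get it, multiply the momentum equation by [dt] times the
    intermediate velocity [w] and the phase equation by the BDF2 difference of
    [phi].  Differences are turned into increments by
      2 a (3a - 4b + c) = a^2 + (2a - b)^2 - b^2 - (2b - c)^2 + (a - 2b + c)^2,
    the projection [w = u + (2 dt / 3) grad q], with [q] the pressure increment,
    turns the pressure terms into the increment of [dt^2 / 3 |grad p|^2], and
    the coupling of [w] with [grad phidot] in the momentum equation cancels
    against the transport term of [phidot].  The squares are those of the
    second differences, of [grad q], and one of the two copies of the [mu5]
    dissipation that the stress produces.  The elimination itself is
    [energy_algebra].

    The boundary conditions say that every flux in these divergences is
    tangential to the boundary.  Hence all that is needed from analysis is
    [divergence_tangential]: the divergence of a field [F], smooth up to the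
    boundary and with [F . m = 0] there, has integral zero.  A partition of
    unity reduces it to a field [G] supported where the domain is [{rho < 0}]
    ([divergence_one_chart]).  Let [k] be
    [cutoff], a C^1 function that vanishes on the positive half-line and tends
    to 1 at minus infinity.  Then [k (n rho) G], extended by zero, is a C^1
    field with compact support in R^d, and its divergence
      k (n rho) div G + n k' (n rho) (G . grad rho)
    has integral zero, by Fubini and the fundamental theorem of calculus along
    lines ([integral_partial_eq0]).  As [G] is tangential, [G . grad rho]
    vanishes on [{rho = 0}], so it is [O(rho)] ([hadamard_bound]).  Since
    [s k' (s)] is bounded, these divergences are bounded uniformly in [n]; on
    the domain they converge pointwise to [div G], and dominated convergence
    concludes. *)

(** * Integration over R^d along coordinate lines *)

Section row_measurability.
Context {R : realType}.
Local Notation mR := (measurableTypeR R).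

Lemma ball_row (d : nat) (x y : 'rV[R]_d) (e : R) : 0 < e ->
  ball x e y <-> forall i, `|x 0 i - y 0 i| < e.
Proof.
move=> e0; split=> [[_ h] i|h]; first exact: (h 0 i).
by split=> // i j; rewrite (ord1 i); exact: h.
Qed.

(** The measurable sets of tuples are generated by the coordinates, so an
    open set is reached as a countable union of boxes with rational corners. *)
Lemma measurable_row_preimage (d : nat) (O : set 'rV[R]_d) : open O ->
  measurable (@row_of_tuple R d @^-1` O).
Proof.
move=> oO.
pose box (q : 'rV[rat]_d * 'rV[rat]_d) : set 'rV[R]_d :=
  [set y | forall i, ratr (q.1 0 i) < y 0 i < ratr (q.2 0 i)].
have -> : row_of_tuple @^-1` O =
    \bigcup_q (row_of_tuple @^-1` [set y | box q y /\ box q `<=` O]).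
  apply/seteqP; split=> [t /= Ot|t [q _ /= [qt qO]]]; last exact: qO.
  have /nbhs_ballP[e /= e0 eO] := open_nbhs_nbhs (conj oO Ot).
  pose x := row_of_tuple t.
  have /choice[a ha] : forall i, exists q : rat,
      x 0 i - e < ratr q < x 0 i.
    move=> i; have /rat_in_itvoo[q] : x 0 i - e < x 0 i by rewrite ltrBlDr ltrDl.
    by rewrite in_itv /=; exists q.
  have /choice[b hb] : forall i, exists q : rat,
      x 0 i < ratr q < x 0 i + e.
    move=> i; have /rat_in_itvoo[q] : x 0 i < x 0 i + e by rewrite ltrDl.
    by rewrite in_itv /=; exists q.
  exists (\row_i a i, \row_i b i) => //=; split=> [i|y yq] /=.
    rewrite !mxE; have /andP[_] := ha i; have /andP[+ _] := hb i.
    by rewrite mxE => -> ->.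
  apply: eO; apply/ball_row => // i; have := yq i; rewrite /= !mxE => /andP[h1 h2].
  have /andP[h3 h4] := ha i; have /andP[h5 h6] := hb i.
  by rewrite mxE in h3 h4 h5 h6; rewrite real_ltr_norml ?num_real//; apply/andP; split; lra.
apply: countable_bigcupT_measurable => [|q]; first exact: countableP.
have [qO|qO] := pselect (box q `<=` O); last first.
  rewrite (_ : _ @^-1` _ = set0) ?measurable0//.
  by rewrite -subset0 => t [].
rewrite (_ : _ @^-1` _ = \big[setI/setT]_(i < d)
    ((@tnth d mR ^~ i) @^-1` `](ratr (q.1 0 i)), (ratr (q.2 0 i))[)).
  apply: bigsetI_measurable => i _; rewrite -[X in measurable X]setTI.
  by apply: measurable_tnth => //; exact: measurable_itv.
rewrite -bigcap_seq; apply/seteqP; split=> [t [/= h _] i /= _|t h /=].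
  by have := h i; rewrite mxE in_itv.
split=> // i; have := h i; rewrite /= mxE in_itv/= => -> //.
by rewrite mem_index_enum.
Qed.

Lemma open_continuous_measurable_row (d : nat) (O : set 'rV[R]_d)
  (g : 'rV[R]_d -> R) : open O -> (forall x, O x -> {for x, continuous g}) ->
  measurable_fun (@row_of_tuple R d @^-1` O) (g \o @row_of_tuple R d).
Proof.
move=> oO cg; apply: (measurability _ (RGenOInfty.measurableE R)).
move=> /= _ [_ [a ->]] <-.
have -> : row_of_tuple @^-1` O `&` (g \o @row_of_tuple R d) @^-1` `]a, +oo[ =
    row_of_tuple @^-1` (O `&` [set x | a < g x]).
  by apply/seteqP; split=> t /=; rewrite in_itv/= andbT.
apply: measurable_row_preimage; rewrite openE => x [Ox /= agx].
apply: filterI; first exact: open_nbhs_nbhs.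
exact: (cg x Ox _ (lt_nbhsr agx)).
Qed.

Definition cube (d : nat) (N : R) : set (d.-tuple mR) :=
  [set t | forall i, `|tnth t i| <= N].

Lemma measurable_cube d N : measurable (@cube d N).
Proof.
rewrite (_ : cube N = \big[setI/setT]_(i < d)
    ((@tnth d mR ^~ i) @^-1` `[- N, N])).
  apply: bigsetI_measurable => i _; rewrite -[X in measurable X]setTI.
  by apply: measurable_tnth => //; exact: measurable_itv.
rewrite -bigcap_seq; apply/seteqP; split=> [t /= h i _|t h i] /=.
  by have := h i; rewrite in_itv/= ler_norml.
have := h i; rewrite /= in_itv/= ler_norml => -> //.
by rewrite mem_index_enum.
Qed.

Lemma lebesgue_Rd_cube_fin d N : (lebesgue_Rd d (cube N) < +oo)%E.
Proof.
elim: d => [|d IH].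
  by rewrite /= diracE; case: (_ \in _); rewrite ltry.
rewrite /= /pushforward.
have -> : @tcons R d @^-1` cube N = `[- N, N] `*` cube N.
  apply/seteqP; split=> [[a t] h|[a t] /= [h1 h2] i].
    split=> /=; first by have := h ord0; rewrite (tnth_nth a)/= in_itv/= ler_norml.
    by move=> i; have := h (lift ord0 i); rewrite tnthS.
  case: (unliftP ord0 i) => [j|] ->; first by rewrite tnthS; exact: h2.
  by move: h1; rewrite (tnth_nth a)/= in_itv/= ler_norml.
rewrite product_measure1E//; last exact: measurable_cube.
apply: lte_mul_pinfty => //.
have := @lebesgue_measure_itv R `[- N, N]; rewrite /= => ->.
  by case: ifP => _ //; rewrite -EFinB ltry.
Qed.

Lemma bounded_support_integrable disp (T : measurableType disp)
  (mu : {measure set T -> \bar R}) (B : set T) (C : R) (g : T -> R) :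
  measurable B -> (mu B < +oo)%E ->
  measurable_fun setT g -> (forall t, `|g t| <= C) ->
  (forall t, ~ B t -> g t = 0) ->
  mu.-integrable setT (EFin \o g).
Proof.
move=> mB muB mg gC g0.
have -> : EFin \o g = (EFin \o g) \_ B.
  apply/funext => t; rewrite /patch; case: ifPn => // /negP.
  by rewrite inE => /g0 /= ->.
apply/integrable_restrict => //; rewrite setTI.
apply: measurable_bounded_integrable => //; first exact: measurable_funTS.
by exists C; split; [exact: num_real|move=> y Cy t _; exact: le_trans (gC t) (ltW Cy)].
Qed.

Definition set_coord d (t : d.-tuple mR) (i : 'I_d) (s : R) : d.-tuple mR :=
  [tuple if j == i then s else tnth t j | j < d].

(** Fubini, in a form that survives the induction on the dimension: a bound
    and a cube of support are inherited by every slice, whereas integrability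
    is only inherited by almost every slice. *)
Lemma integral_lines0 d N C (g : d.-tuple mR -> R) (i : 'I_d) :
  measurable_fun setT g -> (forall t, `|g t| <= C) ->
  (forall t, ~ cube N t -> g t = 0) ->
  (forall t, \int[lebesgue_measure]_s (g (set_coord t i s))%:E = 0)%E ->
  (\int[lebesgue_Rd d]_t (g t)%:E = 0)%E.
Proof.
elim: d g i => [g [] //|d IH] g i mg gC g0 gi.
pose l : {sigma_finite_measure set mR -> \bar R} := @lebesgue_measure R.
pose g' : (mR * d.-tuple mR)%type -> \bar R := (EFin \o g) \o @tcons R d.
have mg' : measurable_fun setT (g \o @tcons R d).
  by apply: measurableT_comp => //; exact: measurable_tcons.
have ig' : (l \x lebesgue_Rd d)%E.-integrable setT g'.
  apply: (@bounded_support_integrable _ _ _ (@tcons R d @^-1` cube N)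
    C (g \o @tcons R d)) => //.
  - rewrite -[X in measurable X]setTI; apply: measurable_tcons => //.
    exact: measurable_cube.
  - exact: (lebesgue_Rd_cube_fin d.+1 N).
  - by move=> z; exact: gC.
  - by move=> z; exact: g0.
transitivity (\int[(l \x lebesgue_Rd d)%E]_z g' z)%E.
  rewrite -[in RHS](preimage_setT (@tcons R d)).
  rewrite -integral_pushforward//.
  - exact: measurable_tcons.
  - exact/measurable_EFinP.
case: (unliftP ord0 i) => [j|] iE.
- rewrite -integral12_prod_meas1//; apply: integral0_eq => a _.
  rewrite /fubini_F; apply: (IH (fun t => g (tcons (a, t))) j).
  + apply: measurableT_comp => //.
    apply: (@measurableT_comp _ _ _ _ _ _ (@tcons R d) _ (pair a)) => //.
    exact: measurable_tcons.
  + by move=> t; exact: gC.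
  + move=> t nt; apply: g0 => h; apply: nt => k.
    by have := h (lift ord0 k); rewrite tnthS.
  + move=> t; rewrite -[RHS](gi (tcons (a, t))); apply: eq_integral => s _.
    congr (g _)%:E; apply: eq_from_tnth => k; rewrite iE !tnth_mktuple.
    case: (unliftP ord0 k) => [k'|] ->.
      by rewrite !tnthS (inj_eq lift_inj) tnth_mktuple.
    by rewrite eqE/= !(tnth_nth a).
- rewrite -integral21_prod_meas1//; apply: integral0_eq => t _.
  rewrite /fubini_G -[RHS](gi (tcons (0, t))); apply: eq_integral => s _.
  congr (g _)%:E; apply: eq_from_tnth => k; rewrite iE !tnth_mktuple.
  case: (unliftP ord0 k) => [k'|] ->; first by rewrite !tnthS eqE/=.
  by rewrite eqxx (tnth_nth s).
Qed.

End row_measurability.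

(** * Calculus of partial derivatives and C^k functions *)

Section differential_calculus.
Context {R : realType}.

(** The difference vanishes near [x], so the zero map is its differential. *)
Lemma near_eq_differentiable (V W : normedModType R) (f g : V -> W) x :
  {near x, f =1 g} -> differentiable f x -> differentiable g x.
Proof.
move=> fg df.
suff dh : differentiable (g - f) x.
  by have := differentiableD dh df; rewrite subrK.
have h0 : \forall y \near x, (g - f) y = 0.
  by near=> y; rewrite !fctE (near fg y) ?subrr//.
have h0' : \forall y \near (0 : V), (g - f) (y + x) = 0.
  have : (fun y : V => y + x) @ (0 : V) --> 0 + x.
    by apply: cvgD; [exact: cvg_id|exact: cvg_cst].
  by rewrite add0r => /(_ _ h0).
have hE : (g - f) \o shift x = cst ((g - f) x) + (\0 : V -> W) +o_ 0 id.
  apply/eqaddoP => _/posnumP[e]; near=> y.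
  have -> : ((g - f) \o shift x - (cst ((g - f) x) + (\0 : V -> W))) y =
      (g - f) (y + x) - ((g - f) x + 0) by [].
  rewrite (near h0' y)// (nbhs_singleton h0).
  by rewrite !addr0 subrr normr0 mulr_ge0.
apply/diff_locallyP.
have -> := @diff_unique _ _ _ (g - f) (\0) x _ hE; last exact: cst_continuous.
by split => //; exact: cst_continuous.
Unshelve. all: by end_near. Qed.

Context {d : nat}.
Implicit Types (f g : 'rV[R]_d -> R) (V : set 'rV[R]_d) (i : 'I_d).

Lemma near_eq_partial i f g x : {near x, f =1 g} -> partial i f x = partial i g x.
Proof. exact: near_eq_derive. Qed.

Lemma partialD i f g x : differentiable f x -> differentiable g x ->
  partial i (fun y => f y + g y) x = partial i f x + partial i g x.
Proof. by move=> df dg; rewrite /partial deriveD//; exact: diff_derivable. Qed.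

Lemma partialM i f g x : differentiable f x -> differentiable g x ->
  partial i (fun y => f y * g y) x = partial i f x * g x + f x * partial i g x.
Proof.
move=> df dg; rewrite /partial [LHS]deriveM//; try exact: diff_derivable.
by rewrite addrC; congr (_ + _); exact: mulrC.
Qed.

Lemma partial_cst i (c : R) x : partial i (fun=> c) x = 0.
Proof. exact: derive_cst. Qed.

Lemma partial_comp i (k : R -> R) f x : differentiable f x ->
  derivable k (f x) 1 ->
  partial i (k \o f) x = derive1 k (f x) * partial i f x.
Proof.
move=> df dk; have dk' : differentiable k (f x) by apply/derivable1_diffP.
rewrite /partial !deriveE//; last exact: differentiable_comp.
rewrite diff_comp//= [in RHS]mulrC derive1E'//.
by rewrite -[in LHS](mulr1 ('d f x _)) [LHS]linearZ.
Qed.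

(** The derivatives of the sums and products below are only known on [V],
    and [Ck_on] does not see what happens outside the open set [V]. *)
Lemma Ck_on_ext k V f g : open V -> (forall x, V x -> f x = g x) ->
  Ck_on k V f -> Ck_on k V g.
Proof.
move=> oV; elim: k f g => [|k IH] f g fg /=.
  move=> cf x Vx; have e : {near x, f =1 g}.
    by near=> y; apply: fg; near: y; exact: open_nbhs_nbhs.
  have := cf x Vx; rewrite /prop_for /continuous_at (fg x Vx).
  by apply: cvg_trans; apply: (near_eq_cvg (F := nbhs x)); apply: filterS e => y ->.
have e x : V x -> {near x, f =1 g}.
  by move=> Vx; near=> y; apply: fg; near: y; exact: open_nbhs_nbhs.
move=> [df Cf]; split=> [x Vx|i].
  exact: near_eq_differentiable (e x Vx) (df x Vx).
apply: IH (Cf i) => x Vx; exact: near_eq_partial (e x Vx).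
Unshelve. all: by end_near. Qed.

Lemma Ck_onW k V f : Ck_on k.+1 V f -> Ck_on k V f.
Proof.
elim: k f => [|k IH] f [df Cf] /=.
  by move=> x Vx; apply: differentiable_continuous; exact: df.
by split=> // i; exact: IH.
Qed.

Lemma Ck_on_sub k (V W : set 'rV[R]_d) f : V `<=` W -> Ck_on k W f -> Ck_on k V f.
Proof.
move=> VW; elim: k f => [|k IH] f /=; first by move=> cf x /VW; exact: cf.
by move=> [df Cf]; split=> [x /VW|i]; [exact: df|exact: IH].
Qed.

Lemma Ck_onD k V f g : open V ->
  Ck_on k V f -> Ck_on k V g -> Ck_on k V (fun x => f x + g x).
Proof.
move=> oV; elim: k f g => [|k IH] f g /=.
  by move=> cf cg x Vx; apply: continuousD; [exact: cf|exact: cg].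
move=> [df Cf] [dg Cg]; split=> [x Vx|i].
  by apply: differentiableD; [exact: df|exact: dg].
apply: Ck_on_ext (IH _ _ (Cf i) (Cg i)) => // x Vx.
by rewrite partialD; [|exact: df|exact: dg].
Qed.

Lemma Ck_onM k V f g : open V ->
  Ck_on k V f -> Ck_on k V g -> Ck_on k V (fun x => f x * g x).
Proof.
move=> oV; elim: k f g => [|k IH] f g.
  by move=> cf cg x Vx; apply: continuousM; [exact: cf|exact: cg].
move=> Cf Cg; have [df pf] := Cf; have [dg pg] := Cg; split=> [x Vx|i].
  by apply: differentiableM; [exact: df|exact: dg].
apply: (@Ck_on_ext _ _ (fun x => partial i f x * g x + f x * partial i g x)) => //.
  by move=> x Vx; rewrite partialM; [|exact: df|exact: dg].
by apply: Ck_onD => //; apply: IH => //; try exact: Ck_onW;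
  [exact: pf|exact: pg].
Qed.

Lemma Ck_on_cst k V (c : R) : Ck_on k V (fun=> c).
Proof.
elim: k c => [|k IH] c /=; first by move=> x _; exact: cst_continuous.
split=> [x _|i]; first exact: differentiable_cst.
by rewrite (_ : partial i _ = fun=> 0)//; apply/funext => x; rewrite partial_cst.
Qed.

Lemma Ck_on_sum k V (I : Type) (r : seq I) (F : I -> 'rV[R]_d -> R) : open V ->
  (forall j, Ck_on k V (F j)) -> Ck_on k V (fun x => \sum_(j <- r) F j x).
Proof.
move=> oV cF; elim: r => [|j r IH].
  rewrite (_ : (fun _ => _) = fun=> 0); first exact: Ck_on_cst.
  by apply/funext => x; rewrite big_nil.
rewrite (_ : (fun _ => _) = fun x => F j x + \sum_(l <- r) F l x).
  by apply: Ck_onD => //; exact: cF.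
by apply/funext => x; rewrite big_cons.
Qed.

Lemma Ck_on_comp1 V (k : R -> R) f :
  (forall s, derivable k s 1) -> continuous (derive1 k) ->
  open V -> Ck_on 1 V f -> Ck_on 1 V (k \o f).
Proof.
move=> dk ck oV [df cf]; split=> [x Vx|i].
  apply: differentiable_comp; first exact: df.
  by apply/derivable1_diffP.
apply: (@Ck_on_ext 0 V (fun x => derive1 k (f x) * partial i f x)) => //.
  by move=> x Vx; rewrite partial_comp//; exact: df.
apply: (@Ck_onM 0) => //; last exact: cf.
move=> x Vx; apply: continuous_comp; last exact: ck.
exact: differentiable_continuous (df _ Vx).
Qed.

Lemma Ck_on_inv1 V f : open V -> (forall x, V x -> f x != 0) ->
  Ck_on 1 V f -> Ck_on 1 V (fun x => (f x)^-1).
Proof.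
move=> oV f0 [df cf]; split=> [x Vx|i].
  by apply: differentiableV; [exact: df|exact: f0].
apply: (@Ck_on_ext 0 V (fun x => - ((f x)^-1 * (f x)^-1) * partial i f x)) => //.
  move=> x Vx; have df' := @diff_derivable _ _ _ f x (delta_mx 0 i) (df x Vx).
  have := deriveV (f0 x Vx) df'; rewrite /partial => ->.
  by rewrite /GRing.scale/= -exprVn expr2.
have cV : Ck_on 0 V (fun x => (f x)^-1).
  move=> x Vx; have cx := differentiable_continuous (df _ Vx).
  exact: (cvgV (f0 x Vx) cx).
apply: (@Ck_onM 0) => //; last exact: cf.
apply: (@Ck_on_ext 0 V (fun x => (-1) * ((f x)^-1 * (f x)^-1))) => //.
  by move=> x Vx; rewrite mulN1r.
apply: (@Ck_onM 0) => //; first exact: (@Ck_on_cst 0).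
exact: (@Ck_onM 0).
Qed.

(** Reduces partial derivatives to the one-variable mean value theorem and
    fundamental theorem of calculus. *)
Lemma is_derive_line i f (x : 'rV[R]_d) (s : R) :
  differentiable f (x + s *: delta_mx 0 i) ->
  is_derive s (1 : R) (fun s => f (x + s *: delta_mx 0 i))
    (partial i f (x + s *: delta_mx 0 i)).
Proof.
move=> df; have dv := @diff_derivable _ _ _ f _ (delta_mx 0 i) df.
pose v : 'rV[R]_d := delta_mx 0 i.
have E : (fun h : R => h^-1 *: (((fun s => f (x + s *: v)) \o shift s) (h *: (1:R))
            - f (x + s *: v))) =
    (fun h => h^-1 *: ((f \o shift (x + s *: v)) (h *: v) - f (x + s *: v))).
  apply/funext => h /=; congr (_ *: (f _ - _)).
  by rewrite [h *: 1]mulr1 scalerDl addrCA.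
apply: DeriveDef; first by rewrite /derivable E.
by rewrite /partial /derive E.
Qed.

End differential_calculus.

(** * Compactly supported functions and bounded domains *)

Section compact_support.
Context {R : realType} {d : nat}.
Implicit Types (f g : 'rV[R]_d -> R) (i : 'I_d).

Lemma compact_cubeR (N : R) : compact [set x : 'rV[R]_d | forall j, `|x 0 j| <= N].
Proof.
rewrite (_ : [set _ | _] =
    [set v : 'rV[R]_d | forall j, `[- N, N]%classic (v ord0 j)]).
  apply: (@rV_compact _ _ (fun=> `[- N, N]%classic)).
  by move=> _; exact: segment_compact.
by apply/seteqP; split=> x /= h j; have := h j; rewrite in_itv/= ler_norml.
Qed.

Lemma compact_continuous_bounded (A : set 'rV[R]_d) f : compact A ->
  (forall x, A x -> {for x, continuous f}) ->
  exists C, forall x, A x -> `|f x| <= C.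
Proof.
move=> cA cf; have : compact (f @` A).
  apply: continuous_compact => //; apply: continuous_in_subspaceT => x.
  by rewrite inE => /cf.
move=> /compact_bounded[M [_ Mf]]; exists (M + 1) => x Ax.
by apply: Mf; [rewrite ltrDl|exists x].
Qed.

(** On each line parallel to the [i]-th axis this is the fundamental theorem
    of calculus for a function that vanishes at both ends. *)
Lemma integral_partial_eq0 i f (N : R) : Ck_on 1 setT f ->
  (forall x : 'rV[R]_d, (exists j, N < `|x 0 j|) -> f x = 0) ->
  (\int[lebesgue_Rd d]_t (partial i f (row_of_tuple t))%:E = 0)%E.
Proof.
move=> [df cf] f0.
have p0 (x : 'rV[R]_d) : (exists j, N < `|x 0 j|) -> partial i f x = 0.
  move=> [j Nx]; rewrite -(partial_cst i 0 x); apply: near_eq_partial.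
  have cx : {for x, continuous (fun y : 'rV[R]_d => `|y 0 j|)}.
    apply: continuous_comp; first exact: coord_continuous.
    exact: norm_continuous.
  have : nbhs x [set y : 'rV[R]_d | N < `|y 0 j|] := cx _ (lt_nbhsr Nx).
  apply: filterS => y /= Ny.
  by apply: f0; exists j.
have [C hC] : exists C, forall x : 'rV[R]_d,
    (forall j, `|x 0 j| <= N) -> `|partial i f x| <= C.
  by apply: (compact_continuous_bounded (@compact_cubeR N)) => x _; exact: cf.
have out (x : 'rV[R]_d) : ~ (forall j, `|x 0 j| <= N) -> exists j, N < `|x 0 j|.
  by move=> /existsNP[j /negP]; rewrite -ltNge; exists j.
apply: (@integral_lines0 _ d N (Num.max C 0) (partial i f \o @row_of_tuple R d) i).
- have := @open_continuous_measurable_row R d setT (partial i f) openT.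
  by rewrite preimage_setT; apply => x _; exact: cf.
- move=> t /=; have [h|h] := pselect (forall j, `|row_of_tuple t 0 j| <= N).
    by rewrite le_max hC.
  by rewrite p0 ?normr0 ?le_max ?lexx ?orbT//; exact: out.
- move=> t nt /=; apply: p0; apply: out => h; apply: nt => j.
  by have := h j; rewrite mxE.
- move=> t /=.
pose x0 := row_of_tuple (set_coord t i 0); pose v : 'rV[R]_d := delta_mx 0 i.
have xE s : row_of_tuple (set_coord t i s) = x0 + s *: v.
  apply/rowP => j; rewrite !mxE !tnth_mktuple eqxx/=.
  by case: eqVneq => _; rewrite ?mulr1 ?add0r ?mulr0 ?addr0.
have xi s : (x0 + s *: v) 0 i = s by rewrite -xE mxE tnth_mktuple eqxx.
under eq_integral do rewrite xE.
pose F s := f (x0 + s *: v); pose g s := partial i f (x0 + s *: v).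
have dF s : is_derive s (1 : R) F (g s) by apply: is_derive_line; exact: df.
(* The function vanishes at both ends of this segment. *)
pose b : R := `|N| + 1.
have Nb : N < b by rewrite ltr_pwDr// ler_norm.
have b0 : 0 < b by rewrite ltr_wpDl.
have cg : continuous g.
  move=> s; apply: (@continuous_comp R^o 'rV[R]_d R^o (fun s : R => x0 + s *: v)
    (partial i f) s).
    apply: continuousD; first exact: cst_continuous.
    by apply: continuousZr_tmp => ?; exact: cvg_id.
  exact: cf.
transitivity (\int[lebesgue_measure]_(s in `[(- b)%R, b]) (g s)%:E)%E.
  rewrite [RHS]integral_mkcond; apply: eq_integral => s _.
  rewrite patchE; case: ifPn => //; rewrite notin_setE /= in_itv/= -ler_norml => /negP.
  rewrite -ltNge => bs; congr EFin; apply: p0; exists i.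
  by rewrite xi (lt_trans Nb).
rewrite (@continuous_FTC2 _ g F)//.
- rewrite /F !f0 ?subee//; exists i; rewrite xi ?normrN gtr0_norm//.
- by rewrite -subr_gt0 opprK addr_gt0.
- exact: continuous_subspaceT.
- have cF s : {for s, continuous F}.
    by apply: differentiable_continuous; apply/derivable1_diffP; apply: ex_derive.
  split=> [s _||]; first exact: ex_derive.
  + by apply: cvg_at_right_filter; exact: cF.
  + by apply: cvg_at_left_filter; exact: cF.
- by move=> s _; rewrite derive1E; exact: derive_val.
Qed.

Lemma continuous_cube_integrable (g : 'rV[R]_d -> R) (N : R) :
  (forall x, {for x, continuous g}) ->
  (forall x : 'rV[R]_d, (exists j, N < `|x 0 j|) -> g x = 0) ->
  (lebesgue_Rd d).-integrable setT (EFin \o (g \o @row_of_tuple R d)).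
Proof.
move=> cg g0.
have [C hC] : exists C, forall x : 'rV[R]_d, (forall j, `|x 0 j| <= N) -> `|g x| <= C.
  by apply: (compact_continuous_bounded (@compact_cubeR N)) => x _; exact: cg.
have out (x : 'rV[R]_d) : ~ (forall j, `|x 0 j| <= N) -> g x = 0.
  by move=> /existsNP[j /negP]; rewrite -ltNge => h; apply: g0; exists j.
apply: (@bounded_support_integrable R _ _ _ (@cube R d N) (Num.max C 0)).
- exact: measurable_cube.
- exact: lebesgue_Rd_cube_fin.
- have := @open_continuous_measurable_row R d setT g openT.
  by rewrite preimage_setT; apply => x _; exact: cg.
- move=> t /=; have [h|h] := pselect (forall j, `|row_of_tuple t 0 j| <= N).
    by rewrite le_max hC.
  by rewrite (out _ h) normr0 le_max lexx orbT.
- move=> t nt /=; apply: out => h; apply: nt => j.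
  by have := h j; rewrite mxE.
Qed.

End compact_support.

Section bounded_domain.
Context {R : realType} {d : nat}.
Variable Omega : set 'rV[R]_d.
Hypotheses (oO : open Omega) (bO : bounded_set Omega).
Local Notation OmegaT := (@row_of_tuple R d @^-1` Omega).

Lemma bounded_set_cube : exists N : R, forall x, Omega x -> forall j, `|x 0 j| <= N.
Proof.
have [M [_ hM]] := bO; exists (M + 1) => x Ox j.
apply: le_trans (hM (M + 1) _ x Ox); last by rewrite ltrDl.
rewrite [leRHS]/Num.norm /= mx_normrE.
by apply/bigmax_geP; right => /=; exists (0, j).
Qed.

(** Makes continuous functions on the closure bounded, hence integrable. *)
Lemma compact_closure : compact (closure Omega).
Proof.
have [N hN] := bounded_set_cube.
pose K := [set x : 'rV[R]_d | forall j, `|x 0 j| <= N].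
have cK : compact K := @compact_cubeR R d N.
apply: (subclosed_compact _ cK); first exact: closed_closure.
have /closure_id -> : closed K by apply: compact_closed => //; exact: norm_hausdorff.
by apply: closure_subset => x Ox j; exact: hN.
Qed.

Lemma measurable_domain : measurable OmegaT.
Proof. exact: measurable_row_preimage. Qed.

Lemma lebesgue_domain_fin : (lebesgue_Rd d OmegaT < +oo)%E.
Proof.
have [N hN] := bounded_set_cube.
apply: le_lt_trans (lebesgue_Rd_cube_fin d N).
apply: le_measure; rewrite ?inE; first exact: measurable_domain.
  exact: measurable_cube.
by move=> t Ot j; have := hN _ Ot j; rewrite mxE.
Qed.

Lemma integrable_domain (V : set 'rV[R]_d) (f : 'rV[R]_d -> R) :
  closure Omega `<=` V -> Ck_on 0 V f ->
  (lebesgue_Rd d).-integrable OmegaT (EFin \o (f \o @row_of_tuple R d)).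
Proof.
move=> OV cf.
have [C hC] := compact_continuous_bounded compact_closure
  (fun x Ox => cf x (OV x Ox)).
apply: measurable_bounded_integrable.
- exact: measurable_domain.
- exact: lebesgue_domain_fin.
- apply: open_continuous_measurable_row => // x Ox.
  by apply: cf; apply: OV; exact: subset_closure.
- exists C; split; first exact: num_real.
  move=> y Cy t Ot; apply: le_trans (ltW Cy); apply: hC.
  exact: subset_closure.
Qed.

End bounded_domain.

(** * A C^1 cut-off function of one real variable *)

Section cutoff.
Context {R : realType}.

(** The square of the negative part, written without a case distinction. *)
Definition sqneg (s : R) : R := ((s - `|s|) / 2) ^+ 2.

Lemma sqneg_pos (s : R) : 0 <= s -> sqneg s = 0.
Proof. by move=> s0; rewrite /sqneg ger0_norm// subrr mul0r expr0n. Qed.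

Lemma sqneg_neg (s : R) : s <= 0 -> sqneg s = s ^+ 2.
Proof. by move=> s0; rewrite /sqneg ler0_norm//; field. Qed.

Lemma sqneg_ge0 (s : R) : 0 <= sqneg s.
Proof. exact: sqr_ge0. Qed.

Lemma sqneg_gt0 (s : R) : s < 0 -> 0 < sqneg s.
Proof. by move=> s0; rewrite sqneg_neg ?ltW// exprn_even_gt0//= lt_eqF. Qed.

Lemma is_derive_sqneg (s : R) : is_derive s (1 : R) sqneg (s - `|s|).
Proof.
have [s0|s0|->] := ltgtP s 0.
- apply: (@near_eq_is_derive _ _ _ (fun x : R => x ^+ 2)).
    near=> y; rewrite sqneg_neg//; apply: ltW; near: y; exact: lt_nbhsl.
  rewrite ltr0_norm// opprK.
  apply: DeriveDef; first exact: exprn_derivable.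
  by rewrite exp_derive expr1 /GRing.scale/=; ring.
- apply: (@near_eq_is_derive _ _ _ (fun x : R => 0)).
    near=> y; rewrite sqneg_pos//; apply: ltW; near: y; exact: lt_nbhsr.
  by rewrite gtr0_norm// subrr; exact: is_derive_cst.
- rewrite normr0 subrr.
  have lim : (fun h : R => h^-1 *: ((sqneg \o shift 0) (h *: (1 : R)) - sqneg 0))
      @ 0^' --> (0 : R).
    have c : (fun h : R => (h - `|h|) / 2) @ (0 : R) --> (0 : R).
      rewrite [X in _ --> X](_ : _ = (0 - `|0 : R|) / 2); last first.
        by rewrite normr0 subrr mul0r.
      apply: cvgM; last exact: cvg_cst.
      by apply: cvgB; [exact: cvg_id|exact: norm_continuous].
    have c' : (fun h : R => (h - `|h|) / 2) @ 0^' --> (0 : R).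
      by apply: cvg_trans c; apply: cvg_app; exact: cvg_within.
    apply: cvg_trans c'; apply: near_eq_cvg.
    near=> h.
    have h0 : h != 0 by near: h; exact: nbhs_dnbhs_neq.
    rewrite /= addr0 [h *: 1]mulr1 (sqneg_pos (lexx 0)) subr0 /GRing.scale/=.
    have [hn|hp] := leP h 0.
      by rewrite sqneg_neg// ler0_norm//; field.
    by rewrite sqneg_pos ?ltW// gtr0_norm// subrr mul0r mulr0.
  apply: DeriveDef; last exact: cvg_lim lim.
  by apply/cvg_ex; exists 0.
Unshelve. all: by end_near. Qed.

(** [s ^ 2 / (1 + s ^ 2)] on the negative half-line and zero elsewhere: the
    double zero at the origin is what makes it C^1. *)
Definition cutoff (s : R) : R := 1 - (1 + sqneg s)^-1.

Let one_sqneg (s : R) : 1 + sqneg s != 0.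
Proof. by rewrite gt_eqF// ltr_pwDl// sqneg_ge0. Qed.

Lemma is_derive_cutoff (s : R) :
  is_derive s (1 : R) cutoff ((s - `|s|) / (1 + sqneg s) ^+ 2).
Proof.
pose w (s : R) : R := 1 + sqneg s.
have h2 : is_derive s (1 : R) w (0 + (s - `|s|)).
  by have h1 := is_derive_sqneg s; apply: is_deriveD.
have d2 : derivable w s (1 : R) by exact: ex_derive.
have w0 : w s != 0 by exact: one_sqneg.
have h3 : is_derive s (1 : R) (fun s => (w s)^-1) (- (w s) ^- 2 *: (0 + (s - `|s|))).
  apply: DeriveDef; first exact: (@derivableV _ _ w s 1 w0 d2).
  by rewrite (@deriveV _ _ w s 1 w0 d2) derive_val.
have h4 : is_derive s (1 : R) cutoff (0 - (- (w s) ^- 2 *: (0 + (s - `|s|)))).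
  by have h0 := is_derive_cst (1 : R) s (1 : R); exact: is_deriveB.
apply: (is_derive_eq h4).
by rewrite /GRing.scale/= !add0r mulNr opprK mulrC.
Qed.

Lemma derive1_cutoff (s : R) : derive1 cutoff s = (s - `|s|) / (1 + sqneg s) ^+ 2.
Proof. by have h := is_derive_cutoff s; rewrite derive1E derive_val. Qed.

Lemma derivable_cutoff (s : R) : derivable cutoff s 1.
Proof. by have h := is_derive_cutoff s; exact: ex_derive. Qed.

Lemma continuous_derive1_cutoff : continuous (derive1 cutoff).
Proof.
rewrite (_ : derive1 cutoff = fun s => (s - `|s|) * ((1 + sqneg s) ^+ 2)^-1); last first.
  by apply/funext => s; rewrite derive1_cutoff.
move=> s.
have c0 : {for s, continuous (fun s : R => s - `|s|)}.
  by apply: cvgB; [exact: cvg_id|exact: norm_continuous].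
apply: cvgM; first exact: c0.
apply: cvgV; first by rewrite expf_neq0.
have c1 : (fun s : R => 1 + sqneg s) x @[x --> s] --> 1 + sqneg s.
  apply: cvgD; first exact: cvg_cst.
  have c2 : (fun s : R => (s - `|s|) / 2) x @[x --> s] --> (s - `|s|) / 2.
    by apply: cvgM; [exact: c0|exact: cvg_cst].
  exact: (cvgM c2 c2).
exact: (cvgM c1 c1).
Qed.

Lemma cutoff_pos (s : R) : 0 <= s -> cutoff s = 0.
Proof. by move=> s0; rewrite /cutoff sqneg_pos// addr0 invr1 subrr. Qed.

Lemma derive1_cutoff_pos (s : R) : 0 <= s -> derive1 cutoff s = 0.
Proof. by move=> s0; rewrite derive1_cutoff ger0_norm// subrr mul0r. Qed.

Lemma cutoff_norm_le1 (s : R) : `|cutoff s| <= 1.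
Proof.
rewrite /cutoff; set y := (_ + _)^-1.
have y0 : 0 <= y by rewrite invr_ge0 addr_ge0// sqneg_ge0.
have y1 : y <= 1 by rewrite invf_le1 ?lerDl ?sqneg_ge0// ltr_pwDl// sqneg_ge0.
by rewrite ger0_norm; lra.
Qed.

(** Gives both the uniform bound [2], used as a dominating function, and,
    for [s] replaced by a large multiple of [s], a quantity that tends to zero. *)
Lemma cutoff_derive_bound (s : R) : s < 0 ->
  `|derive1 cutoff s * s| <= 2 * (1 + s ^+ 2)^-1.
Proof.
move=> s0; rewrite derive1_cutoff (ltr0_norm s0) sqneg_neg; last exact: ltW.
have s2 : 0 <= s ^+ 2 := sqr_ge0 s.
have s1 : 0 < 1 + s ^+ 2 by lra.
have -> : (s - - s) / (1 + s ^+ 2) ^+ 2 * s = 2 * s ^+ 2 / (1 + s ^+ 2) ^+ 2.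
  by field; rewrite gt_eqF.
rewrite ger0_norm; last by apply: divr_ge0; [rewrite mulr_ge0|rewrite exprn_ge0// ltW].
have -> : 2 * (1 + s ^+ 2)^-1 = (2 * (1 + s ^+ 2)) / (1 + s ^+ 2) ^+ 2.
  by field; rewrite gt_eqF.
by rewrite ler_pM2r ?invr_gt0 ?exprn_gt0//; lra.
Qed.

Lemma cvg_inv_onep_sqr (s : R) : s != 0 ->
  (fun n : nat => (1 + (n.+1%:R * s) ^+ 2)^-1) @ \oo --> (0 : R).
Proof.
move=> s0; have s2 : 0 < s ^+ 2 by rewrite exprn_even_gt0.
apply: (@squeeze_cvgr _ _ _ _ (cst 0) (fun n => (s ^+ 2)^-1 * n.+1%:R^-1)).
- near=> n; apply/andP; split; first by rewrite invr_ge0 addr_ge0// sqr_ge0.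
  have q1 : 0 < 1 + (n.+1%:R * s) ^+ 2 by rewrite ltr_pwDl// sqr_ge0.
  have q2 : 0 < s ^+ 2 * n.+1%:R by rewrite mulr_gt0.
  rewrite -invfM lef_pV2 ?posrE//.
  rewrite exprMn mulrC; apply: (@le_trans _ _ (n.+1%:R ^+ 2 * s ^+ 2)); last by rewrite lerDr.
  by rewrite ler_pM2r// expr2 ler_peMr// ler1n.
- exact: cvg_cst.
- rewrite -[X in _ --> X](mulr0 (s ^+ 2)^-1); apply: cvgM; first exact: cvg_cst.
  exact: cvg_harmonic.
Unshelve. all: by end_near. Qed.

End cutoff.

(** * A Hadamard type bound near a smooth hypersurface *)

Section hadamard.
Context {R : realType} {d : nat}.
Implicit Types (f g rho : 'rV[R]_d -> R) (i : 'I_d) (V : set 'rV[R]_d).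
Local Notation e_ i := (delta_mx 0 i : 'rV[R]_d).

Lemma within_line_continuous i f (x : 'rV[R]_d) (a b : R) :
  (forall s, a <= s <= b -> differentiable f (x + s *: e_ i)) ->
  {within `[a, b], continuous (fun s => f (x + s *: e_ i))}.
Proof.
move=> df; apply: continuous_in_subspaceT => s; rewrite inE/= in_itv/= => sab.
have h := is_derive_line (df s sab).
by apply: differentiable_continuous; apply/derivable1_diffP; apply: ex_derive.
Qed.

Lemma line_mvt i f (x : 'rV[R]_d) (s : R) :
  (forall r, `|r| <= `|s| -> differentiable f (x + r *: e_ i)) ->
  exists2 r, `|r| <= `|s| &
    f (x + s *: e_ i) - f x = partial i f (x + r *: e_ i) * s.
Proof.
move=> df; have x0 : x = x + 0 *: e_ i by rewrite scale0r addr0.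
have [s0|s0] := leP 0 s.
- have [r||r rs E] := @MVT_segment R (fun r => f (x + r *: e_ i))
    (fun r => partial i f (x + r *: e_ i)) 0 s s0.
  + rewrite in_itv/= => /andP[r0 rs]; apply: is_derive_line; apply: df.
    by rewrite (gtr0_norm r0) (ger0_norm s0) ltW.
  + apply: within_line_continuous => r /andP[r0 rs]; apply: df.
    by rewrite !ger0_norm.
  + move: rs; rewrite in_itv/= => /andP[r0 rs]; exists r.
      by rewrite !ger0_norm.
    by rewrite {2}x0 E subr0.
- have [r||r rs E] := @MVT_segment R (fun r => f (x + r *: e_ i))
    (fun r => partial i f (x + r *: e_ i)) s 0 (ltW s0).
  + rewrite in_itv/= => /andP[r0 rs]; apply: is_derive_line; apply: df.
    by rewrite (ltr0_norm s0) (ltr0_norm rs) lerN2 ltW.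
  + apply: within_line_continuous => r /andP[r0 rs]; apply: df.
    by rewrite (ltr0_norm s0) (ler0_norm rs) lerN2.
  + move: rs; rewrite in_itv/= => /andP[r0 rs]; exists r.
      by rewrite (ltr0_norm s0) (ler0_norm rs) lerN2.
    by rewrite {2}x0 -opprB E sub0r mulrN opprK.
Qed.

Lemma norm_delta_le1 i (s : R) : `|s *: e_ i| <= `|s|.
Proof.
rewrite normrZ ler_piMr// [leLHS]/Num.norm /= mx_normrE.
apply: bigmax_le => // -[j k] _ /=; rewrite mxE.
by case: (_ && _); rewrite ?normr1 ?normr0.
Qed.

(** Some coordinate derivative of [rho] is bounded away from zero near [x0].
    Moving along that coordinate from [x], one meets the zero set of [rho]
    within a distance at most a multiple of [|rho x|]; there [g] vanishes, and
    [g] is Lipschitz along the way. *)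
Lemma hadamard_bound V rho g (x0 : 'rV[R]_d) : open V -> V x0 ->
  Ck_on 1 V rho -> Ck_on 1 V g -> rho x0 = 0 -> grad rho x0 != 0 ->
  (forall x, V x -> rho x = 0 -> g x = 0) ->
  exists C, \forall x \near x0, `|g x| <= C * `|rho x|.
Proof.
move=> oV Vx0 [dr cr] [dg cg] r0 gr0 hg.
have [i ai] : exists i, partial i rho x0 != 0.
  apply/existsP; rewrite -negb_forall; apply: contra gr0 => /forallP h.
  by apply/eqP/colP => i; rewrite !mxE; exact/eqP/h.
pose a := partial i rho x0; pose c := `|a| / 2.
have c0 : 0 < c by rewrite divr_gt0// normr_gt0.
pose L := `|partial i g x0| + 1.
have : \forall x \near x0, V x /\ `|partial i rho x - a| < c /\ `|partial i g x| < L.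
  apply: filterI; first exact: open_nbhs_nbhs.
  apply: filterI.
    have := cr i x0 Vx0; move/cvgr_dist_lt => /(_ c c0).
    by apply: filterS => y; rewrite distrC.
  by have /cvgr_norm_lt := cg i x0 Vx0; apply; rewrite /L ltrDl.
move=> /nbhs_ballP[e /= e0 he].
pose h := e / 4; have h0 : 0 < h by rewrite divr_gt0.
have nr : \forall x \near x0, `|rho x| < c * h.
  have /cvgr_norm_lt := differentiable_continuous (dr x0 Vx0).
  by apply; rewrite r0 normr0 mulr_gt0.
exists (L / c); near=> x.
have xe : `|x0 - x| < e / 2.
  near: x; apply/nbhs_ballP; exists (e / 2); first by rewrite /= divr_gt0.
  by move=> y; rewrite -ball_normE.
have rx : `|rho x| < c * h by near: x.
have inb s : `|s| <= h -> ball x0 e (x + s *: e_ i).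
  move=> sh; rewrite -ball_normE /ball_/= opprD addrA.
  apply: le_lt_trans (ler_normB _ _) _.
  have := le_trans (norm_delta_le1 i s) sh; rewrite /h => ?; lra.
have dro s : `|s| <= h -> differentiable rho (x + s *: e_ i).
  by move=> /inb/he[Vs _]; exact: dr.
have dgo s : `|s| <= h -> differentiable g (x + s *: e_ i).
  by move=> /inb/he[Vs _]; exact: dg.
pose F s := rho (x + s *: e_ i).
have F0 : F 0 = rho x by rewrite /F scale0r addr0.
have Fs s : `|s| <= h -> exists2 D, `|D - a| < c & F s - F 0 = D * s.
  move=> sh; have [|r rs E] := @line_mvt i rho x s.
    by move=> r rs; apply: dro; exact: le_trans rs sh.
  exists (partial i rho (x + r *: e_ i)); last by rewrite F0.
  by have [_ []] := he _ (inb _ (le_trans rs sh)).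
have [s0 s0h Fs0] : exists2 s, `|s| <= h & F s = 0.
  have [|||s] := @IVT R F (- h) h 0.
  - by rewrite lerNl; lra.
  - apply: within_line_continuous => s; rewrite -ler_norml; exact: dro.
  - have [D1 hD1 E1] := Fs h (ltac:(by rewrite gtr0_norm)).
    have [D2 hD2 E2] := Fs (- h) (ltac:(by rewrite normrN gtr0_norm)).
    rewrite F0 in E1 E2; move: hD1 hD2 rx; rewrite !ltr_norml /c.
    move=> /andP[h1 h2] /andP[h3 h4] /andP[h5 h6].
    rewrite ge_min le_max; move: h1 h2 h3 h4 h5 h6.
    (* The derivative keeps the sign of a, so rho changes sign along the line. *)
    have [a0|a0] := ger0P a => h1 h2 h3 h4 h5 h6.
      have q1 : a / 2 * h <= D1 * h by rewrite ler_pM2r//; lra.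
      have q2 : a / 2 * h <= D2 * h by rewrite ler_pM2r//; lra.
      by apply/andP; split; apply/orP; [left|right]; lra.
    have q1 : D1 * h <= a / 2 * h by rewrite ler_pM2r//; lra.
    have q2 : D2 * h <= a / 2 * h by rewrite ler_pM2r//; lra.
    by apply/andP; split; apply/orP; [right|left]; lra.
  - by rewrite in_itv/= -ler_norml => sh E; exists s.
have s0r : c * `|s0| <= `|rho x|.
  have [D hD E] := Fs _ s0h; rewrite Fs0 F0 sub0r in E.
  rewrite -[leRHS]normrN E normrM ler_wpM2r//.
  have := lerB_dist a (a - D); rewrite subKr distrC => q.
  by move: hD q; rewrite /c; lra.
have gx : `|g x| <= L * `|s0|.
  have [|r rs E] := @line_mvt i g x s0.
    by move=> r rs; apply: dgo; exact: le_trans rs s0h.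
  have [Vs _] := he _ (inb _ s0h).
  rewrite (hg _ Vs Fs0) sub0r in E; rewrite -[leLHS]normrN E normrM ler_wpM2r//.
  by have [_ [_ /ltW]] := he _ (inb _ (le_trans rs s0h)).
apply: le_trans gx _; rewrite -mulrA ler_wpM2l ?addr_ge0//.
by rewrite ler_pdivlMl.
Unshelve. all: by end_near. Qed.

End hadamard.

(** * The divergence theorem in one boundary chart *)

Section local_divergence.
Context {R : realType} {d : nat}.
Implicit Types (f g rho : 'rV[R]_d -> R) (i : 'I_d) (V : set 'rV[R]_d).

Lemma Ck_on_local k V f :
  (forall x, V x -> exists U, [/\ open U, U x & Ck_on k U f]) -> Ck_on k V f.
Proof.
elim: k f => [|k IH] f h /=.
  by move=> x Vx; have [U [oU Ux cf]] := h x Vx; exact: cf.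
split=> [x Vx|i]; first by have [U [oU Ux [df _]]] := h x Vx; exact: df.
by apply: IH => x Vx; have [U [oU Ux [_ cf]]] := h x Vx; exists U; split=> //; exact: cf.
Qed.

Lemma open_near_eq V f g x : open V -> V x -> (forall y, V y -> f y = g y) ->
  {near x, f =1 g}.
Proof.
move=> oV Vx fg; near=> y; apply: fg; near: y; exact: open_nbhs_nbhs.
Unshelve. all: by end_near. Qed.

Lemma partial_open_eq0 V f x i : open V -> V x -> (forall y, V y -> f y = 0) ->
  partial i f x = 0.
Proof.
move=> oV Vx f0; rewrite -(partial_cst i 0 x).
by apply: near_eq_partial; exact: open_near_eq oV Vx f0.
Qed.

Section one_chart.
Variables (Omega V W A : set 'rV[R]_d) (rho : 'rV[R]_d -> R)
  (G : 'rV[R]_d -> 'cV[R]_d) (C : R).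
Hypotheses (oO : open Omega) (bO : bounded_set Omega).
Hypotheses (oV : open V) (OV : closure Omega `<=` V).
Hypothesis (cG : forall i, Ck_on 1 V (fun x => G x i 0)).
Hypotheses (oW : open W) (cA : closed A) (AW : A `<=` W).
Hypotheses (crho : Ck_on 1 W rho) (Orho : forall x, W x -> (Omega x <-> rho x < 0)).
Hypothesis (GA : forall x, ~ A x -> G x = 0).
Hypothesis (Gbound : forall x, Omega x -> A x ->
  `|dotv (G x) (grad rho x)| <= C * `|rho x|).

Let cutG (n : nat) (i : 'I_d) : 'rV[R]_d -> R :=
  fun x => cutoff (n.+1%:R * rho x) * G x i 0.

Let cutG0 n i x : ~ Omega x -> cutG n i x = 0.
Proof.
move=> Ox; rewrite /cutG; have [Ax|/GA ->] := pselect (A x); last by rewrite mxE mulr0.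
rewrite cutoff_pos ?mul0r// mulr_ge0// leNgt.
by apply/negP => /(Orho (AW Ax)).
Qed.

Let cutGA n i x : ~ A x -> cutG n i x = 0.
Proof. by move=> /GA; rewrite /cutG => ->; rewrite mxE mulr0. Qed.

(** Only near the closure of the domain is the field known to be
    differentiable; elsewhere the cut-off field vanishes on a neighbourhood. *)
Let chart n i x : closure Omega x -> A x -> exists U, [/\ open U, U x,
  Ck_on 1 U rho, Ck_on 1 U (fun x => G x i 0) &
  Ck_on 1 U (cutoff \o (fun x => n.+1%:R * rho x))].
Proof.
move=> Ox Ax; exists (V `&` W).
have oU : open (V `&` W) by exact: openI.
have r1 : Ck_on 1 (V `&` W) rho by apply: Ck_on_sub crho => ? [].
have ck : Ck_on 1 (V `&` W) (cutoff \o (fun x => n.+1%:R * rho x)).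
  apply: (Ck_on_comp1 (@derivable_cutoff R) (@continuous_derive1_cutoff R) oU).
  by apply: (Ck_onM oU _ r1); exact: (@Ck_on_cst _ _ 1).
split; [exact: oU|by split; [exact: OV|exact: AW]|exact: r1| |exact: ck].
by apply: Ck_on_sub (cG i) => ? [].
Qed.

Let ccutG n i : Ck_on 1 setT (cutG n i).
Proof.
apply: Ck_on_local => x _.
have [Ox|Ox] := pselect (closure Omega x); last first.
  exists (~` closure Omega); split => //.
    by apply: closed_openC; exact: closed_closure.
  apply: (@Ck_on_ext _ _ 1 _ (fun=> 0)).
  - by apply: closed_openC; exact: closed_closure.
  - by move=> y Oy; rewrite cutG0// => /subset_closure.
  - exact: (@Ck_on_cst _ _ 1).
have [Ax|Ax] := pselect (A x); last first.
  exists (~` A); split => //; first exact: closed_openC.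
  apply: (@Ck_on_ext _ _ 1 _ (fun=> 0)).
  - exact: closed_openC.
  - by move=> y Ay; rewrite cutGA.
  - exact: (@Ck_on_cst _ _ 1).
have [U [oU Ux _ cGi ck]] := chart n i Ox Ax.
by exists U; split; [exact: oU|exact: Ux|exact: (Ck_onM oU ck cGi)].
Qed.

Let divcutG n x := \sum_i partial i (cutG n i) x.

Let divcutGE n x : closure Omega x -> A x ->
  divcutG n x = n.+1%:R * derive1 cutoff (n.+1%:R * rho x) * dotv (G x) (grad rho x)
    + cutoff (n.+1%:R * rho x) * div G x.
Proof.
move=> Ox Ax; rewrite /divcutG /div mulr_sumr /dotv mxE mulr_sumr -big_split/=.
apply: eq_bigr => i _; rewrite !mxE.
have [U [oU Ux [dr _] [dGi _] [dk _]]] := chart n i Ox Ax.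
have dnr : differentiable (fun y => n.+1%:R * rho y) x.
  by apply: differentiableM; [exact: differentiable_cst|exact: dr].
rewrite /cutG (@partialM _ _ i (cutoff \o (fun y => n.+1%:R * rho y)))//; last first.
- exact: dGi.
- exact: dk.
rewrite partial_comp//; last exact: derivable_cutoff.
rewrite (@partialM _ _ i (fun=> n.+1%:R))//; last exact: dr.
rewrite partial_cst mul0r add0r /=; ring.
Qed.

Let divcutG0 n x : ~ Omega x -> divcutG n x = 0.
Proof.
move=> Ox; have [cOx|cOx] := pselect (closure Omega x); last first.
  rewrite /divcutG big1// => i _; apply: (@partial_open_eq0 (~` closure Omega)) => //.
    by apply: closed_openC; exact: closed_closure.
  by move=> y Oy; rewrite cutG0// => /subset_closure.
have [Ax|Ax] := pselect (A x); last first.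
  rewrite /divcutG big1// => i _; apply: (@partial_open_eq0 (~` A)) => //.
    exact: closed_openC.
  by move=> y Ay; rewrite cutGA.
have r0 : 0 <= n.+1%:R * rho x.
  by rewrite mulr_ge0// leNgt; apply/negP => /(Orho (AW Ax)).
by rewrite divcutGE// cutoff_pos// derive1_cutoff_pos// mulr0 !mul0r addr0.
Qed.

Let divcutGA n x : ~ A x -> divcutG n x = 0.
Proof.
move=> Ax; rewrite /divcutG big1// => i _; apply: (@partial_open_eq0 (~` A)) => //.
  exact: closed_openC.
by move=> y Ay; rewrite cutGA.
Qed.

Let divGA x : ~ A x -> div G x = 0.
Proof.
move=> Ax; rewrite /div big1// => i _; apply: (@partial_open_eq0 (~` A)) => //.
  exact: closed_openC.
by move=> y /GA ->; rewrite mxE.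
Qed.

Let cdivcutG n x : {for x, continuous (divcutG n)}.
Proof.
apply: (@Ck_on_sum R d 0 setT _ _ (fun i => partial i (cutG n i))) => //.
  exact: openT.
by move=> i; have [_ c] := ccutG n i; exact: (c i).
Qed.

Let continuous_divG : Ck_on 0 V (div G).
Proof.
apply: (@Ck_on_sum R d 0 V _ _ (fun i => partial i (fun y => G y i 0))) => //.
by move=> i; have [_ c] := cG i; exact: (c i).
Qed.

Let int_divcutG n :
  (\int[lebesgue_Rd d]_(t in @row_of_tuple R d @^-1` Omega)
     (divcutG n (row_of_tuple t))%:E = 0)%E.
Proof.
have [N hN] := bounded_set_cube bO.
have far (x : 'rV[R]_d) : (exists j, N < `|x 0 j|) -> ~ Omega x.
  by move=> [j Nj] /hN /(_ j); rewrite leNgt Nj.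
rewrite integral_mkcond.
transitivity (\int[lebesgue_Rd d]_t \sum_i (partial i (cutG n i) (row_of_tuple t))%:E)%E.
  apply: eq_integral => t _; rewrite patchE sumEFin; case: ifPn => //.
  by rewrite notin_setE => Ot; rewrite -/(divcutG _ _) divcutG0.
rewrite integral_sum//; last first.
  move=> i; apply: (@continuous_cube_integrable R d (partial i (cutG n i)) N).
    by move=> x; have [_ c] := ccutG n i; exact: (c i x I).
  move=> x [j Nj].
  apply: (@partial_open_eq0 [set y : 'rV[R]_d | N < `|y 0 j|]) => //.
    rewrite openE => y Ny.
    have cy : {for y, continuous (fun y : 'rV[R]_d => `|y 0 j|)}.
      apply: continuous_comp; first exact: coord_continuous.
      exact: norm_continuous.
    exact: (cy _ (lt_nbhsr Ny)).
  by move=> y Ny; apply: cutG0; apply: far; exists j.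
rewrite big1// => i _; apply: (@integral_partial_eq0 R d i (cutG n i) N) => // x /far.
exact: cutG0.
Qed.

(** Dominated convergence for the fields [cutoff (n rho) G], each of which
    has a divergence of integral zero. *)
Lemma divergence_one_chart :
  (\int[lebesgue_Rd d]_(t in @row_of_tuple R d @^-1` Omega)
     (div G (row_of_tuple t))%:E = 0)%E.
Proof.
pose mu := @lebesgue_Rd R d; pose D := @row_of_tuple R d @^-1` Omega.
have mD : measurable D by exact: measurable_domain.
have [C1 hC1] := compact_continuous_bounded (compact_closure bO)
  (fun x Ox => continuous_divG (OV Ox)).
(* C1 bounds div G, and the factor 2 comes from cutoff_derive_bound. *)
pose B := C1 + 2 * `|C|.
have bound n x : Omega x -> `|divcutG n x| <= B.
  move=> Ox; have cOx := subset_closure Ox.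
  have C10 : 0 <= C1 := le_trans (normr_ge0 _) (hC1 _ cOx).
  have [Ax|Ax] := pselect (A x); last first.
    by rewrite divcutGA// normr0 /B addr_ge0// mulr_ge0.
  have r0 : rho x < 0 by apply/(Orho (AW Ax)).
  have nr0 : n.+1%:R * rho x < 0 by rewrite pmulr_rlt0.
  rewrite divcutGE// /B addrC; apply: le_trans (ler_normD _ _) _.
  apply: lerD.
    rewrite normrM -[leRHS]mul1r; apply: ler_pM => //; first exact: cutoff_norm_le1.
    exact: hC1.
  rewrite normrM.
  have h1 := Gbound Ox Ax; have h2 := cutoff_derive_bound nr0.
  have h3 : 2 * (1 + (n.+1%:R * rho x) ^+ 2)^-1 <= 2.
    rewrite ler_piMr// invf_le1 ?lerDl ?sqr_ge0//.
    by rewrite ltr_pwDl// sqr_ge0.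
  apply: (@le_trans _ _ (`|n.+1%:R * derive1 cutoff (n.+1%:R * rho x)| * (`|C| * `|rho x|))).
    apply: ler_wpM2l => //; apply: le_trans h1 _; apply: ler_wpM2r => //.
    exact: ler_norm.
  have -> : `|n.+1%:R * derive1 cutoff (n.+1%:R * rho x)| * (`|C| * `|rho x|) =
      `|C| * `|derive1 cutoff (n.+1%:R * rho x) * (n.+1%:R * rho x)|.
    by rewrite !normrM; ring.
  by rewrite mulrC; apply: ler_wpM2r => //; exact: le_trans h2 h3.
have lim x : Omega x -> (fun n => divcutG n x) @ \oo --> div G x.
  move=> Ox; have cOx := subset_closure Ox.
  have [Ax|Ax] := pselect (A x); last first.
    rewrite divGA//; have -> : (fun n => divcutG n x) = fun=> 0.
      by apply/funext => n; rewrite divcutGA.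
    exact: cvg_cst.
  have r0 : rho x < 0 by apply/(Orho (AW Ax)).
  have rn0 : rho x != 0 by rewrite lt_eqF.
  have -> : (fun n => divcutG n x) = (fun n => n.+1%:R *
      derive1 cutoff (n.+1%:R * rho x) * dotv (G x) (grad rho x)
      + cutoff (n.+1%:R * rho x) * div G x).
    by apply/funext => n; rewrite divcutGE.
  have l0 := cvg_inv_onep_sqr rn0.
  rewrite -[X in _ --> X]add0r; apply: cvgD.
    rewrite -(mul0r (dotv (G x) (grad rho x))); apply: cvgM; last exact: cvg_cst.
    apply: norm_cvg0.
    apply: (@squeeze_cvgr _ _ _ _ (cst 0)
      (fun n => 2 / `|rho x| * (1 + (n.+1%:R * rho x) ^+ 2)^-1)).
    - near=> n; apply/andP; split; first by rewrite /= normr_ge0.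
      have nr0 : n.+1%:R * rho x < 0 by rewrite pmulr_rlt0.
      rewrite mulrAC ler_pdivlMr ?normr_gt0// -normrM.
      have -> : n.+1%:R * derive1 cutoff (n.+1%:R * rho x) * rho x =
          derive1 cutoff (n.+1%:R * rho x) * (n.+1%:R * rho x) by ring.
      exact: cutoff_derive_bound.
    - exact: cvg_cst.
    - by rewrite -[X in _ --> X](mulr0 (2 / `|rho x|)); apply: cvgM => //; exact: cvg_cst.
  rewrite -[X in _ --> X]mul1r; apply: cvgM; last exact: cvg_cst.
  rewrite -[X in _ --> X]subr0.
  have -> : (fun n : nat => cutoff (n.+1%:R * rho x)) =
      (fun n : nat => 1 - (1 + (n.+1%:R * rho x) ^+ 2)^-1).
    by apply/funext => n; rewrite /cutoff sqneg_neg// ltW// pmulr_rlt0.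
  by apply: cvgB => //; exact: cvg_cst.
have mdiv n : measurable_fun D (fun t => (divcutG n (row_of_tuple t))%:E).
  apply/measurable_EFinP.
  by have c := @cdivcutG n; apply: (@open_continuous_measurable_row _ _ _ (divcutG n)).
have mdivG : measurable_fun D (fun t => (div G (row_of_tuple t))%:E).
  apply/measurable_EFinP; apply: (@open_continuous_measurable_row _ _ _ (div G)) => //.
  by move=> x Ox; apply: continuous_divG; apply: OV; exact: subset_closure.
have iB : mu.-integrable D (EFin \o cst B).
  apply: measurable_bounded_integrable => //; first exact: lebesgue_domain_fin.
  exact: bounded_cst.
have [_ _] := @dominated_convergence _ _ R mu D mD
  (fun n t => (divcutG n (row_of_tuple t))%:E) (fun t => (div G (row_of_tuple t))%:E)
  (cst B%:E) mdiv mdivG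
  (ltac:(by apply: aeW => t Dt /=; apply: cvg_EFin; [exact: nearW|exact: lim]))
  iB
  (ltac:(by apply: aeW => t n Dt /=; rewrite lee_fin; exact: bound)).
rewrite (_ : [sequence _]_n = fun=> 0%E); last first.
  by apply/funext => n; exact: int_divcutG.
by move=> /(cvg_unique _ (cvg_cst _)) => <-.
Unshelve. all: by end_near. Qed.

End one_chart.
End local_divergence.

(** * Bumps and defining functions *)

Section bump.
Context {R : realType} {d : nat}.

Lemma partial_coord (i j : 'I_d) (x : 'rV[R]_d) :
  partial i (fun y : 'rV[R]_d => y 0 j) x = (j == i)%:R.
Proof.
pose f : 'rV[R]_d -> R := fun y => y 0 j.
have df : differentiable f (x + 0 *: delta_mx 0 i) by exact: differentiable_coord.
have h := is_derive_line df.
have x0 : x = x + 0 *: delta_mx 0 i by rewrite scale0r addr0.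
rewrite x0 -[LHS](@derive_val _ _ _ _ _ _ _ h).
rewrite (_ : (fun s : R => f (x + s *: delta_mx 0 i)) =
  (fun s : R => x 0 j + s * (j == i)%:R)); last first.
  by apply/funext => s; rewrite /f !mxE eqxx.
have h2 : is_derive (0 : R) (1 : R) (fun s : R => x 0 j + s * (j == i)%:R)
    (0 + (j == i)%:R *: 1).
  apply: is_deriveD; apply: DeriveDef.
    apply: derivableM; [exact: derivable_id|exact: derivable_cst].
  by rewrite deriveMr ?derive_id.
by rewrite derive_val add0r /GRing.scale/= mulr1.
Qed.

Lemma Ck_on_coord V (j : 'I_d) : Ck_on 1 V (fun y : 'rV[R]_d => y 0 j).
Proof.
split=> [x _|i]; first exact: differentiable_coord.
rewrite (_ : partial i _ = fun=> (j == i)%:R); first exact: (@Ck_on_cst _ _ 0).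
by apply/funext => x; rewrite partial_coord.
Qed.

(** A C^1 function that is positive exactly on the open Euclidean ball.  That
    ball is contained in the ball of the same radius for the maximum norm,
    which is the norm of row vectors. *)
Definition bump (x : 'rV[R]_d) (r : R) (y : 'rV[R]_d) : R :=
  sqneg (\sum_j (y 0 j - x 0 j) * (y 0 j - x 0 j) - r * r).

Lemma Ck_on_bump x r : Ck_on 1 setT (bump x r).
Proof.
have dq (s : R) : derivable (@sqneg R) s 1.
  by have h := is_derive_sqneg s; exact: ex_derive.
have cq : continuous (derive1 (@sqneg R)).
  rewrite (_ : derive1 _ = fun s => s - `|s|); last first.
    by apply/funext => s; rewrite derive1E; have h := is_derive_sqneg s; exact: derive_val.
  by move=> s; apply: cvgB; [exact: cvg_id|exact: norm_continuous].
apply: (Ck_on_comp1 dq cq openT); apply: (Ck_onD openT); last exact: (@Ck_on_cst _ _ 1).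
apply: (Ck_on_sum _ openT) => j.
have h : Ck_on 1 setT (fun y : 'rV[R]_d => y 0 j - x 0 j).
  apply: (Ck_onD openT); [exact: Ck_on_coord|exact: (@Ck_on_cst _ _ 1)].
exact: (Ck_onM openT h h).
Qed.

Lemma bump_ge0 x r y : 0 <= bump x r y. Proof. exact: sqneg_ge0. Qed.

Lemma bump_center x r : 0 < r -> 0 < bump x r x.
Proof.
move=> r0; apply: sqneg_gt0; rewrite big1; first by rewrite sub0r oppr_lt0 mulr_gt0.
by move=> j _; rewrite subrr mul0r.
Qed.

Lemma bump_support x r y : 0 < r -> r < `|x - y| -> bump x r y = 0.
Proof.
move=> r0 xy; apply: sqneg_pos; rewrite subr_ge0.
have [j hj] : exists j, r < `|(x - y) 0 j|.
  move: xy; rewrite [X in _ < X -> _]/Num.norm/= mx_normrE => /bigmax_gtP[|[[k j] _ /=]].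
    by rewrite ltNge ltW.
  by rewrite (ord1 k); exists j.
rewrite (bigD1 j)//= ler_wpDr//.
  by apply: sumr_ge0 => k _; rewrite -expr2 sqr_ge0.
rewrite -[leRHS]ger0_norm -?expr2 ?sqr_ge0// normrX expr2 -normrN opprB.
by move: hj; rewrite !mxE => hj; apply: ler_pM; rewrite ?ltW.
Qed.

Lemma partial_sum (I : Type) (r : seq I) (i : 'I_d) (f : I -> 'rV[R]_d -> R) x :
  (forall j, differentiable (f j) x) ->
  partial i (fun y => \sum_(j <- r) f j y) x = \sum_(j <- r) partial i (f j) x.
Proof.
move=> df; suff [] : differentiable (fun y => \sum_(j <- r) f j y) x /\
  partial i (fun y => \sum_(j <- r) f j y) x = \sum_(j <- r) partial i (f j) x by [].
elim: r => [|j r [IHd IH]].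
  rewrite big_nil (_ : (fun _ => _) = fun=> 0).
    by split; [exact: differentiable_cst|exact: partial_cst].
  by apply/funext => y; rewrite big_nil.
rewrite big_cons (_ : (fun _ => _) = fun y => f j y + \sum_(k <- r) f k y).
  split; first by apply: differentiableD.
  by rewrite partialD// IH.
by apply/funext => y; rewrite big_cons.
Qed.

End bump.

Section defining_functions.
Context {R : realType} {d : nat}.
Variables (Omega V : set 'rV[R]_d) (rho : 'rV[R]_d -> R).
Hypothesis hrho : defining_function Omega V rho.

Lemma defining_function_bdry x : open Omega -> V x -> bdry Omega x -> rho x = 0.
Proof.
move: hrho => [oV sr _ Or] oO Vx [cx ix].
have nOx : ~ Omega x by move=> Ox; apply: ix; exact: open_nbhs_nbhs.
apply/eqP; rewrite eq_le; apply/andP; split; rewrite leNgt; apply/negP => rx.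
  have cr : {for x, continuous rho} := sr 0%N x Vx.
  have n1 : nbhs x (V `&` [set y | 0 < rho y]).
    apply: filterI; first exact: open_nbhs_nbhs.
    exact: (cr _ (lt_nbhsr rx)).
  have [y [Oy [Vy /= ry]]] := cx _ n1.
  by move: Oy => /(Or y Vy); rewrite ltNge ltW.
by apply: nOx; apply/(Or x Vx).
Qed.

(** If the domain had no point near [x], then [rho], being nonnegative
    there, would have a minimum at [x], against [grad rho x != 0]. *)
Lemma defining_function_zero x : V x -> rho x = 0 -> bdry Omega x.
Proof.
move: hrho => [oV sr gr Or] Vx r0.
have nOx : ~ Omega x by move=> /(Or x Vx); rewrite r0 ltxx.
split; last by move=> /interior_subset.
apply: contrapT => ncx.
have n1 : nbhs x (V `&` ~` Omega).
  apply: filterI; first exact: open_nbhs_nbhs.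
  move: ncx => /existsNP[B /not_implyP[nB h]].
  apply: filterS nB => y By Oy; apply: h; by exists y.
have [i ai] : exists i, partial i rho x != 0.
  apply/existsP; rewrite -negb_forall; apply: contra (gr x Vx) => /forallP h.
  by apply/eqP/colP => i; rewrite !mxE; exact/eqP/h.
have [dr _] := sr 1%N.
move: n1 => /nbhs_ballP[e /= e0 he].
have inb s : s \in `](- e), e[ -> (V `&` ~` Omega) (x + s *: delta_mx 0 i).
  rewrite in_itv/= -ltr_norml => se; apply: he; rewrite -ball_normE /ball_/=.
  rewrite opprD addrA subrr sub0r normrN.
  exact: le_lt_trans (norm_delta_le1 i s) se.
pose r_ (s : R) : R := rho (x + s *: delta_mx 0 i).
have dline (s : R) : s \in `](- e), e[ ->
    is_derive s (1 : R) r_ (partial i rho (x + s *: delta_mx 0 i)).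
  by move=> /inb[Vs _]; apply: is_derive_line; exact: dr.
have i0 : (0 : R) \in `](- e), e[ by rewrite in_itv/= oppr_lt0 e0.
have h1 : - e <= e by lra.
have h4 : is_derive (0 : R) (1 : R) r_ 0.
  apply: (derive1_at_min h1 _ i0) => t tI.
    by have h := dline t tI; exact: ex_derive.
  have [Vt nOt] := inb t tI; rewrite {1}/r_ scale0r addr0 r0 leNgt.
  by apply/negP => rt; apply: nOt; apply/(Or _ Vt).
have h5 := dline 0 i0.
have := @derive_val _ _ _ _ _ _ _ h5; rewrite (@derive_val _ _ _ _ _ _ _ h4).
by rewrite scale0r addr0 => /esym/eqP; rewrite (negbTE ai).
Qed.

End defining_functions.

(** * Column vectors *)

Section column_vectors.
Context {R : realType} {d : nat}.
Implicit Types (a b c : 'cV[R]_d).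

Lemma frob_neq0 (a : 'cV[R]_d) : a != 0 -> frob a != 0.
Proof.
apply: contra; rewrite /frob sqrtr_eq0 => a0.
have h i : (a i 0) ^+ 2 = 0.
  apply/eqP; rewrite eq_le sqr_ge0 andbT; apply: le_trans a0.
  rewrite (bigD1 i)//= big_ord1 lerDl; apply: sumr_ge0 => j _.
  by apply: sumr_ge0 => k _; exact: sqr_ge0.
apply/eqP/colP => i; rewrite mxE; apply/eqP.
by have /eqP := h i; rewrite sqrf_eq0.
Qed.

Lemma dotvE (a b : 'cV[R]_d) : dotv a b = \sum_i a i 0 * b i 0.
Proof. by rewrite /dotv mxE; apply: eq_bigr => i _; rewrite mxE. Qed.

Lemma dotvZl (k : R) a b : dotv (k *: a) b = k * dotv a b.
Proof. by rewrite !dotvE mulr_sumr; apply: eq_bigr => i _; rewrite mxE mulrA. Qed.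

Lemma dotvZr (k : R) a b : dotv a (k *: b) = k * dotv a b.
Proof. by rewrite !dotvE mulr_sumr; apply: eq_bigr => i _; rewrite mxE mulrCA. Qed.

Lemma dotvC a b : dotv a b = dotv b a.
Proof. by rewrite !dotvE; apply: eq_bigr => i _; rewrite mulrC. Qed.

Lemma dotvDl a b c : dotv (a + b) c = dotv a c + dotv b c.
Proof. by rewrite !dotvE -big_split; apply: eq_bigr => i _; rewrite mxE mulrDl. Qed.

Lemma dotvDr a b c : dotv a (b + c) = dotv a b + dotv a c.
Proof. by rewrite dotvC dotvDl !(dotvC a). Qed.

Lemma dotv0l a : dotv 0 a = 0.
Proof. by rewrite dotvE big1// => i _; rewrite mxE mul0r. Qed.

Lemma dotvv_ge0 a : 0 <= dotv a a.
Proof. by rewrite dotvE; apply: sumr_ge0 => i _; rewrite -expr2 sqr_ge0. Qed.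

Lemma dotvNl a b : dotv (- a) b = - dotv a b.
Proof. by rewrite -scaleN1r dotvZl mulN1r. Qed.

(** Stated for arbitrary vectors so that bilinearity does not expand the
    differences and the form that the vectors stand for. *)
Lemma dotv_momentum (k l : R) (X B S P Z w : 'cV[R]_d) :
  k *: X + B - S + P - l *: Z = 0 ->
  k * dotv X w + dotv B w - dotv S w + dotv P w - l * dotv Z w = 0.
Proof.
by move=> /(congr1 (fun a => dotv a w)); rewrite dotv0l !dotvDl !dotvNl !dotvZl.
Qed.

Lemma dotv_projection (k l : R) (c b g : 'cV[R]_d) :
  dotv (c + k *: g) (b + l *: g) =
  dotv c b + l * dotv g c + k * dotv g b + k * l * dotv g g.
Proof. by rewrite !dotvDl !dotvDr !dotvZl !dotvZr (dotvC c g); ring. Qed.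

(** The stability of BDF2: an increment of two squares, up to a square of a
    second difference, the numerical dissipation. *)
Lemma bdf2_polarization a b c :
  dotv a a + dotv (2 *: a - b) (2 *: a - b) - dotv b b - dotv (2 *: b - c) (2 *: b - c) =
  2 * dotv (a *+ 3 - b *+ 4 + c) a - dotv (a - b *+ 2 + c) (a - b *+ 2 + c).
Proof.
rewrite !dotvE mulr_sumr -!sumrN -!big_split; apply: eq_bigr => i _ /=.
rewrite !mxE; ring.
Qed.

End column_vectors.

(** * The divergence theorem for fields without normal flux *)

Section tangential_divergence.
Context {R : realType} {d : nat}.
Variables (Omega : set 'rV[R]_d) (m : 'rV[R]_d -> 'cV[R]_d).
Hypotheses (hOmega : bounded_smooth_domain Omega) (hm : outward_normal Omega m).
Local Notation OmegaT := (@row_of_tuple R d @^-1` Omega).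

Lemma smooth_barv_Ck (F : 'rV[R]_d -> 'cV[R]_d) : smooth_barv Omega F ->
  exists V, [/\ open V, closure Omega `<=` V &
    forall k i, Ck_on k V (fun x => F x i 0)].
Proof.
move=> /choice[V hV]; exists [set x | forall i, V i x]; split.
- rewrite openE => x /= Vx; apply: (@filter_forall _ _ V (nbhs x)) => i.
  by have [oV _ _] := hV i; apply: open_nbhs_nbhs; split.
- by move=> x cx i; have [_ + _] := hV i; exact.
- by move=> k i; have [_ _ sV] := hV i; apply: Ck_on_sub (sV k) => x; exact.
Qed.

Section local_chart.
Variables (V : set 'rV[R]_d) (F : 'rV[R]_d -> 'cV[R]_d).
Hypotheses (oV : open V) (OV : closure Omega `<=` V).
Hypothesis cF : forall i, Ck_on 1 V (fun x => F x i 0).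
Hypothesis tF : no_flux Omega m F.

(** Inside the domain the constant [-1] serves as defining function; at the
    boundary tangency provides the bound of [hadamard_bound].  The multiplier
    [eta] is arbitrary because the functions of the partition of unity can be
    normalized only after the radii of the balls have been chosen; they are
    C^1 only on the smaller open set [V1] where the sum of the bumps is
    positive. *)
Lemma local_chart x : closure Omega x -> exists2 r, 0 < r &
  forall V1 eta, open V1 -> V1 `<=` V -> closure Omega `<=` V1 ->
    Ck_on 1 V1 eta -> (forall y, r < `|x - y| -> eta y = 0) ->
    (\int[lebesgue_Rd d]_(t in OmegaT)
      (div (fun y => eta y *: F y) (row_of_tuple t))%:E = 0)%E.
Proof.
have [oO _ _ bO hbd] := hOmega.
move=> cx.
pose ball_ (r : R) := [set y : 'rV[R]_d | `|x - y| <= r].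
have closed_ball_ r : closed (ball_ r) by exact: closed_closed_ball_.
have ball_nbhs (P : set 'rV[R]_d) : nbhs x P -> exists2 r, 0 < r & ball_ r `<=` P.
  move=> /nbhs_ballP[e /= e0 eP]; exists (e / 2); first by rewrite divr_gt0.
  move=> y /= ye; apply: eP; rewrite -ball_normE /ball_/=.
  by apply: le_lt_trans ye _; lra.
have cEta V1 eta : open V1 -> V1 `<=` V -> Ck_on 1 V1 eta ->
    forall i, Ck_on 1 V1 (fun y => (eta y *: F y) i 0).
  move=> oV1 V1V ceta i.
  rewrite (_ : (fun _ => _) = fun y => eta y * F y i 0); last first.
    by apply/funext => y; rewrite mxE.
  by apply: (Ck_onM oV1 ceta); exact: Ck_on_sub (cF i).
have [Ox|Ox] := pselect (Omega x).
  have [r r0 hr] := ball_nbhs Omega (open_nbhs_nbhs (conj oO Ox)).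
  exists r => // V1 eta oV1 V1V OV1 ceta eta0.
  apply: (@divergence_one_chart R d Omega V1 Omega (ball_ r) (fun=> -1)
    (fun y => eta y *: F y) 0) => //.
  - exact: cEta.
  - exact: (@Ck_on_cst _ _ 1).
  - move=> y ny; rewrite eta0 ?scale0r// ltNge; exact/negP.
  - move=> y Oy _; rewrite mul0r dotvE big1 ?normr0// => i _.
    by rewrite !mxE partial_cst mulr0.
have bx : bdry Omega x by split => // /interior_subset.
have [W [rho [Wx hrho]]] := hbd x bx.
have [oW srho grho Orho] := hrho.
pose g y := dotv (F y) (grad rho y).
have oVW : open (V `&` W) by exact: openI.
have VWV : V `&` W `<=` V by move=> ? [].
have VWW : V `&` W `<=` W by move=> ? [].
have VWx : (V `&` W) x by split=> //; exact: OV.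
have cg : Ck_on 1 (V `&` W) g.
  rewrite (_ : g = fun y => \sum_i F y i 0 * partial i rho y); last first.
    by apply/funext => y; rewrite /g dotvE; apply: eq_bigr => i _; rewrite mxE.
  apply: (Ck_on_sum _ oVW) => i; apply: (Ck_onM oVW).
    exact: Ck_on_sub VWV (cF i).
  by have [_ c2] := srho 2%N; exact: (@Ck_on_sub _ _ 1 _ _ _ VWW (c2 i)).
have [C hC] : exists C, \forall y \near x, `|g y| <= C * `|rho y|.
  apply: (hadamard_bound oVW VWx _ cg).
  - exact: Ck_on_sub VWW (srho 1%N).
  - exact: (defining_function_bdry hrho).
  - exact: grho.
  - move=> y [Vy Wy] ry; have byO := defining_function_zero hrho Wy ry.
    have := tF byO; rewrite (hm byO Wy hrho) dotvZr => /eqP.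
    rewrite mulf_eq0 invr_eq0 (negbTE (frob_neq0 (grho y Wy)))/=.
    by move/eqP.
have [r r0 hr] : exists2 r, 0 < r &
    ball_ r `<=` W `&` [set y | `|g y| <= C * `|rho y|].
  by apply: ball_nbhs; apply: filterI => //; exact: open_nbhs_nbhs.
exists r => // V1 eta oV1 V1V OV1 ceta eta0.
(* The factor eta only changes the constant of the bound. *)
have [Meta hMeta] : exists Meta, forall y, closure Omega y -> `|eta y| <= Meta.
  apply: (compact_continuous_bounded (compact_closure bO)) => y cy.
  by apply: (Ck_onW ceta); exact: OV1.
apply: (@divergence_one_chart R d Omega V1 W (ball_ r) rho
  (fun y => eta y *: F y) (Meta * C)) => //.
- exact: cEta.
- by move=> y /hr[].
- move=> y ny; rewrite eta0 ?scale0r// ltNge; exact/negP.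
- move=> y Oy /hr[_ /= gy]; rewrite dotvZl normrM -mulrA.
  by apply: ler_pM => //; apply: hMeta; exact: subset_closure.
Qed.

End local_chart.

Lemma Ck_on_open_gt0 (f : 'rV[R]_d -> R) : Ck_on 1 setT f ->
  open [set y | 0 < f y].
Proof.
move=> [df _]; rewrite openE => y /= fy.
have cf : {for y, continuous f} := differentiable_continuous (df y I).
exact: (cf _ (lt_nbhsr fy)).
Qed.

(** Decomposes [F] with the partition of unity obtained from finitely many
    bumps, divided by their sum. *)
Lemma divergence_tangential (F : 'rV[R]_d -> 'cV[R]_d) :
  smooth_barv Omega F -> no_flux Omega m F ->
  (\int[lebesgue_Rd d]_(t in OmegaT) (div F (row_of_tuple t))%:E = 0)%E.
Proof.
move=> /smooth_barv_Ck[V [oV OV cF]] tF.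
have [oO _ _ bO _] := hOmega.
have /choice[r hr] : forall x, exists r, 0 < r /\ (closure Omega x ->
  forall V1 eta, open V1 -> V1 `<=` V -> closure Omega `<=` V1 ->
    Ck_on 1 V1 eta -> (forall y, r < `|x - y| -> eta y = 0) ->
    (\int[lebesgue_Rd d]_(t in OmegaT)
      (div (fun y => eta y *: F y) (row_of_tuple t))%:E = 0)%E).
  move=> x; have [cx|cx] := pselect (closure Omega x); last by exists 1.
  by have [r r0 hr] := local_chart oV OV (cF 1%N) tF cx; exists r.
pose b x := bump x (r x).
have cb x : Ck_on 1 setT (b x) := Ck_on_bump x (r x).
have := compact_closure bO; rewrite compact_cover.
move=> /(_ 'rV[R]_d (closure Omega) (fun x => [set y | 0 < b x y])).
have ob x : open [set y | 0 < b x y].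
  exact: Ck_on_open_gt0 (cb x).
case=> [x _ //||D' D'O cov].
  by move=> x cx; exists x => //; apply: bump_center; have [] := hr x.
pose S y := \sum_(x <- finmap.enum_fset D') b x y.
have cS : Ck_on 1 setT S by apply: (Ck_on_sum _ openT).
(* Where the sum of the bumps is zero, division by it need not be smooth. *)
pose V1 := V `&` [set y | 0 < S y].
have oV1 : open V1.
  by apply: openI => //; exact: Ck_on_open_gt0 cS.
have V1V : V1 `<=` V by move=> ? [].
have OV1 : closure Omega `<=` V1.
  move=> y cy; split; first exact: OV.
  have [x /= xD bxy] := cov y cy.
  rewrite /S/= (big_rem x)//= ltr_pwDl//; apply: sumr_ge0 => z _; exact: bump_ge0.
pose eta x y := b x y / S y.
have ceta x : Ck_on 1 V1 (eta x).
  apply: (Ck_onM oV1); first exact: Ck_on_sub (cb x).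
  apply: (Ck_on_inv1 oV1); last exact: Ck_on_sub cS.
  by move=> y [_ /= Sy]; rewrite gt_eqF.
have sum1 y : V1 y -> \sum_(x <- finmap.enum_fset D') eta x y = 1.
  by move=> [_ /= Sy]; rewrite -mulr_suml divff// gt_eqF.
have cetaF x i : Ck_on 1 V1 (fun y => (eta x y *: F y) i 0).
  rewrite (_ : (fun _ => _) = fun y => eta x y * F y i 0); last first.
    by apply/funext => y; rewrite mxE.
  by apply: (Ck_onM oV1 (ceta x)); exact: Ck_on_sub (cF 1%N i).
have cdiv x : Ck_on 0 V1 (div (fun y => eta x y *: F y)).
  apply: (Ck_on_sum _ oV1) => i.
  by have [_ c] := cetaF x i; exact: (c i).
have divE y : V1 y ->
    div F y = \sum_(x <- finmap.enum_fset D') div (fun y => eta x y *: F y) y.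
  move=> Vy; rewrite /div exchange_big/=; apply: eq_bigr => i _.
  rewrite -partial_sum; last by move=> x; have [dx _] := cetaF x i; exact: dx.
  apply: near_eq_partial; apply: (open_near_eq oV1) => // z Vz.
  under eq_bigr do rewrite mxE.
  by rewrite -mulr_suml sum1// mul1r.
transitivity (\int[lebesgue_Rd d]_(t in OmegaT)
  \sum_(x <- finmap.enum_fset D') (div (fun y => eta x y *: F y) (row_of_tuple t))%:E)%E.
  apply: eq_integral => t /set_mem Ot; rewrite sumEFin; congr EFin.
  by apply: divE; apply: OV1; exact: subset_closure.
rewrite integral_sum; last 2 first.
- exact: measurable_domain.
- by move=> x; apply: (integrable_domain oO bO OV1 (cdiv x)).
rewrite big_seq big1// => x xD.
have [r0 hx] := hr x; apply: (hx _ V1 (eta x)) => //.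
  by have /set_mem := D'O x xD.
by move=> y xy; rewrite /eta /b bump_support ?mul0r.
Qed.

End tangential_divergence.

(** * Fields that are smooth up to the boundary *)

Section smooth_fields.
Context {R : realType} {d : nat}.
Variable Omega : set 'rV[R]_d.
Implicit Types (f g : 'rV[R]_d -> R) (F : 'rV[R]_d -> 'cV[R]_d).

Lemma smooth_bar_cst (c : R) : smooth_bar Omega (fun=> c).
Proof. by exists setT; split=> // [|k]; [exact: openT|exact: Ck_on_cst]. Qed.

Lemma smooth_barD f g : smooth_bar Omega f -> smooth_bar Omega g ->
  smooth_bar Omega (fun x => f x + g x).
Proof.
move=> [V [oV OV sf]] [W [oW OW sg]]; exists (V `&` W).
have oVW : open (V `&` W) by exact: openI.
split=> // [x cx|k]; first by split; [exact: OV|exact: OW].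
apply: Ck_onD => //; first by apply: Ck_on_sub (sf k) => ? [].
by apply: Ck_on_sub (sg k) => ? [].
Qed.

Lemma smooth_barM f g : smooth_bar Omega f -> smooth_bar Omega g ->
  smooth_bar Omega (fun x => f x * g x).
Proof.
move=> [V [oV OV sf]] [W [oW OW sg]]; exists (V `&` W).
have oVW : open (V `&` W) by exact: openI.
split=> // [x cx|k]; first by split; [exact: OV|exact: OW].
apply: Ck_onM => //; first by apply: Ck_on_sub (sf k) => ? [].
by apply: Ck_on_sub (sg k) => ? [].
Qed.

Lemma smooth_barZ c f : smooth_bar Omega f -> smooth_bar Omega (fun x => c * f x).
Proof. by move=> sf; apply: smooth_barM => //; exact: smooth_bar_cst. Qed.

Lemma smooth_barN f : smooth_bar Omega f -> smooth_bar Omega (fun x => - f x).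
Proof.
move=> sf; rewrite (_ : (fun _ => _) = fun x => -1 * f x); first exact: smooth_barZ.
by apply/funext => x; rewrite mulN1r.
Qed.

Lemma smooth_barB f g : smooth_bar Omega f -> smooth_bar Omega g ->
  smooth_bar Omega (fun x => f x - g x).
Proof. by move=> sf sg; apply: smooth_barD => //; exact: smooth_barN. Qed.

Lemma smooth_barX f k : smooth_bar Omega f -> smooth_bar Omega (fun x => f x ^+ k).
Proof.
move=> sf; elim: k => [|k IH].
  rewrite (_ : (fun _ => _) = fun=> 1); first exact: smooth_bar_cst.
  by apply/funext => x; rewrite expr0.
rewrite (_ : (fun _ => _) = fun x => f x * f x ^+ k); first exact: smooth_barM.
by apply/funext => x; rewrite exprS.
Qed.

Lemma smooth_bar_sum (I : Type) (r : seq I) (F : I -> 'rV[R]_d -> R) :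
  (forall j, smooth_bar Omega (F j)) ->
  smooth_bar Omega (fun x => \sum_(j <- r) F j x).
Proof.
move=> sF; elim: r => [|j r IH].
  rewrite (_ : (fun _ => _) = fun=> 0); first exact: smooth_bar_cst.
  by apply/funext => x; rewrite big_nil.
rewrite (_ : (fun _ => _) = fun x => F j x + \sum_(k <- r) F k x).
  exact: smooth_barD.
by apply/funext => x; rewrite big_cons.
Qed.

Lemma smooth_bar_partial i f : smooth_bar Omega f -> smooth_bar Omega (partial i f).
Proof.
by move=> [V [oV OV sf]]; exists V; split=> // k; have [_] := sf k.+1; exact.
Qed.

Lemma smooth_barv_grad f : smooth_bar Omega f -> smooth_barv Omega (grad f).
Proof.
move=> sf i; rewrite (_ : (fun _ => _) = partial i f); first exact: smooth_bar_partial.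
by apply/funext => x; rewrite mxE.
Qed.

Lemma smooth_bar_div F : smooth_barv Omega F -> smooth_bar Omega (div F).
Proof. by move=> sF; apply: smooth_bar_sum => i; exact: smooth_bar_partial. Qed.

Lemma smooth_bar_dotv F G : smooth_barv Omega F -> smooth_barv Omega G ->
  smooth_bar Omega (fun x => dotv (F x) (G x)).
Proof.
move=> sF sG; rewrite (_ : (fun _ => _) = fun x => \sum_i F x i 0 * G x i 0).
  by apply: smooth_bar_sum => i; exact: smooth_barM.
by apply/funext => x; rewrite dotvE.
Qed.

Lemma smooth_barvZ f F : smooth_bar Omega f -> smooth_barv Omega F ->
  smooth_barv Omega (fun x => f x *: F x).
Proof.
move=> sf sF i; rewrite (_ : (fun _ => _) = fun x => f x * F x i 0).
  exact: smooth_barM.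
by apply/funext => x; rewrite mxE.
Qed.

Lemma smooth_barvD F G : smooth_barv Omega F -> smooth_barv Omega G ->
  smooth_barv Omega (fun x => F x + G x).
Proof.
move=> sF sG i; rewrite (_ : (fun _ => _) = fun x => F x i 0 + G x i 0).
  exact: smooth_barD.
by apply/funext => x; rewrite mxE.
Qed.

Definition smooth_barm m n (S : 'rV[R]_d -> 'M[R]_(m, n)) :=
  forall i j, smooth_bar Omega (fun x => S x i j).

Lemma smooth_barm_mul m n k (S : 'rV[R]_d -> 'M[R]_(m, n))
  (T : 'rV[R]_d -> 'M[R]_(n, k)) : smooth_barm S -> smooth_barm T ->
  smooth_barm (fun x => S x *m T x).
Proof.
move=> sS sT i j; rewrite (_ : (fun _ => _) = fun x => \sum_l S x i l * T x l j).
  by apply: smooth_bar_sum => l; exact: smooth_barM.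
by apply/funext => x; rewrite mxE.
Qed.

Lemma smooth_barm_tr m n (S : 'rV[R]_d -> 'M[R]_(m, n)) :
  smooth_barm S -> smooth_barm (fun x => (S x)^T).
Proof.
by move=> sS i j; rewrite (_ : (fun _ => _) = fun x => S x j i)//;
  apply/funext => x; rewrite mxE.
Qed.

Lemma smooth_barmD m n (S T : 'rV[R]_d -> 'M[R]_(m, n)) :
  smooth_barm S -> smooth_barm T -> smooth_barm (fun x => S x + T x).
Proof.
move=> sS sT i j; rewrite (_ : (fun _ => _) = fun x => S x i j + T x i j).
  exact: smooth_barD.
by apply/funext => x; rewrite mxE.
Qed.

Lemma smooth_barmZ m n f (S : 'rV[R]_d -> 'M[R]_(m, n)) :
  smooth_bar Omega f -> smooth_barm S -> smooth_barm (fun x => f x *: S x).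
Proof.
move=> sf sS i j; rewrite (_ : (fun _ => _) = fun x => f x * S x i j).
  exact: smooth_barM.
by apply/funext => x; rewrite mxE.
Qed.

Lemma smooth_barv_barm F : smooth_barv Omega F -> smooth_barm F.
Proof. by move=> sF i j; rewrite (ord1 j). Qed.

Lemma smooth_barm_barv F : smooth_barm F -> smooth_barv Omega F.
Proof. by move=> sF i; exact: sF. Qed.

Lemma smooth_barm_symgrad F : smooth_barv Omega F -> smooth_barm (symgrad F).
Proof.
move=> sF; have sg : smooth_barm (gradv F).
  move=> i j; rewrite (_ : (fun _ => _) = partial j (fun y => F y i 0)).
    exact: smooth_bar_partial.
  by apply/funext => x; rewrite mxE.
apply: smooth_barmZ; first exact: smooth_bar_cst.
by apply: smooth_barmD => //; exact: smooth_barm_tr.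
Qed.

Lemma smooth_bar_quadform F (S : 'rV[R]_d -> 'M[R]_d) :
  smooth_barm S -> smooth_barv Omega F ->
  smooth_bar Omega (fun x => quadform (S x) (F x)).
Proof.
move=> sS sF; have sF' := smooth_barv_barm sF.
have h := smooth_barm_mul (smooth_barm_mul (smooth_barm_tr sF') sS) sF'.
exact: (h 0 0).
Qed.

Lemma smooth_barm_stress mu1 mu4 mu5 F f : smooth_barv Omega F ->
  smooth_bar Omega f -> smooth_barm (stress mu1 mu4 mu5 F f).
Proof.
move=> sF sf; have sD := smooth_barm_symgrad sF.
have sg := smooth_barv_grad sf; have sg' := smooth_barv_barm sg.
have sDg := smooth_barm_mul sD sg'.
apply: smooth_barmD; first apply: smooth_barmD.
- apply: smooth_barmZ; first by apply: smooth_barZ; exact: smooth_bar_quadform.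
  by apply: smooth_barm_mul => //; exact: smooth_barm_tr.
- by apply: smooth_barmZ => //; exact: smooth_bar_cst.
- apply: smooth_barmZ; first exact: smooth_bar_cst.
  by apply: smooth_barmD; apply: smooth_barm_mul => //; exact: smooth_barm_tr.
Qed.

Lemma smooth_bar_differentiable f x : smooth_bar Omega f -> closure Omega x ->
  differentiable f x.
Proof. by move=> [V [oV OV sf]] cx; have [df _] := sf 1%N; exact: df (OV x cx). Qed.

Lemma gradD f g x : smooth_bar Omega f -> smooth_bar Omega g -> closure Omega x ->
  grad (fun y => f y + g y) x = grad f x + grad g x.
Proof.
move=> sf sg cx; apply/colP => i; rewrite !mxE.
by apply: partialD; exact: smooth_bar_differentiable.
Qed.

Lemma gradZ c f x : smooth_bar Omega f -> closure Omega x ->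
  grad (fun y => c * f y) x = c *: grad f x.
Proof.
move=> sf cx; apply/colP => i; rewrite !mxE (@partialM _ _ i (fun=> c)).
- by rewrite partial_cst mul0r add0r.
- exact: differentiable_cst.
- exact: smooth_bar_differentiable.
Qed.

Lemma divD F G x : smooth_barv Omega F -> smooth_barv Omega G -> closure Omega x ->
  div (fun y => F y + G y) x = div F x + div G x.
Proof.
move=> sF sG cx; rewrite /div -big_split; apply: eq_bigr => i _ /=.
rewrite -partialD; [|exact: smooth_bar_differentiable..].
by congr (partial i _ x); apply/funext => y; rewrite mxE.
Qed.

Lemma divZ f F x : smooth_bar Omega f -> smooth_barv Omega F -> closure Omega x ->
  div (fun y => f y *: F y) x = dotv (grad f x) (F x) + f x * div F x.
Proof.
move=> sf sF cx; rewrite dotvE /div mulr_sumr -big_split; apply: eq_bigr => i _ /=.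
rewrite [grad f x i 0]mxE.
rewrite -(@partialM _ _ i f (fun y => F y i 0)); [|exact: smooth_bar_differentiable..].
by congr (partial i _ x); apply/funext => y; rewrite mxE.
Qed.

(** The transpose appears because [divm] differentiates along the second
    index. *)
Lemma div_tr_mul (S : 'rV[R]_d -> 'M[R]_d) F x :
  smooth_barm S -> smooth_barv Omega F -> closure Omega x ->
  div (fun y => (S y)^T *m F y) x =
    dotv (divm S x) (F x) + \sum_i \sum_j S x i j * gradv F x i j.
Proof.
move=> sS sF cx; rewrite /div.
have E j : partial j (fun y => ((S y)^T *m F y) j 0) x =
    \sum_i (partial j (fun y => S y i j) x * F x i 0 + S x i j * gradv F x i j).
  rewrite (_ : (fun y => ((S y)^T *m F y) j 0) = fun y => \sum_i S y i j * F y i 0).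
    rewrite partial_sum; last first.
      by move=> i; apply: smooth_bar_differentiable cx; exact: smooth_barM.
    apply: eq_bigr => i _; rewrite [gradv _ _ _ _]mxE.
    by apply: (@partialM _ _ j (fun y => S y i j) (fun y => F y i 0));
      exact: smooth_bar_differentiable.
  by apply/funext => y; rewrite mxE; apply: eq_bigr => i _; rewrite mxE.
under eq_bigr do rewrite E.
rewrite exchange_big/= dotvE -big_split; apply: eq_bigr => i _ /=.
by rewrite big_split/= [divm S x i 0]mxE mulr_suml.
Qed.

End smooth_fields.

(** * Matrices, the algebra of one step, and integrals over the domain *)

Section linear_algebra.
Context {R : realType} {d : nat}.
Implicit Types (a b c g : 'cV[R]_d) (A B G : 'M[R]_d).

(** The Frobenius inner product. *)
Definition mxdot A B : R := \sum_i \sum_j A i j * B i j.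

Lemma mxdotDl A B G : mxdot (A + B) G = mxdot A G + mxdot B G.
Proof.
rewrite /mxdot -big_split; apply: eq_bigr => i _ /=.
by rewrite -big_split; apply: eq_bigr => j _; rewrite mxE mulrDl.
Qed.

Lemma mxdotZl k A G : mxdot (k *: A) G = k * mxdot A G.
Proof.
rewrite /mxdot mulr_sumr; apply: eq_bigr => i _ /=.
by rewrite mulr_sumr; apply: eq_bigr => j _; rewrite mxE mulrA.
Qed.

Lemma mxdot_tr A B : mxdot A^T B^T = mxdot A B.
Proof.
rewrite /mxdot exchange_big/=; apply: eq_bigr => i _.
by apply: eq_bigr => j _; rewrite !mxE.
Qed.

Lemma mxdotC A B : mxdot A B = mxdot B A.
Proof. by apply: eq_bigr => i _; apply: eq_bigr => j _; rewrite mulrC. Qed.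

(** A symmetric matrix only sees the symmetric part of [G]. *)
Lemma mxdot_sym A G : A^T = A -> mxdot A G = mxdot A (2^-1 *: (G + G^T)).
Proof.
move=> sA; rewrite mxdotC [RHS]mxdotC mxdotZl mxdotDl -[in mxdot G^T A]sA mxdot_tr.
by field.
Qed.

Lemma mxdot_outer a b G : mxdot (a *m b^T) G = dotv a (G *m b).
Proof.
rewrite dotvE; apply: eq_bigr => i _; rewrite mxE mulr_sumr.
by apply: eq_bigr => j _; rewrite !mxE big_ord1 !mxE; ring.
Qed.

(** The two [mu5] terms of the stress contribute equally. *)
Lemma stress_power mu1 mu4 mu5 G g (D := 2^-1 *: (G + G^T)) :
  mxdot ((mu1 * quadform D g) *: (g *m g^T) + mu4 *: D
         + mu5 *: ((D *m g) *m g^T + g *m (D *m g)^T)) G =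
  mu1 * quadform D g ^+ 2 + mu4 * mxdot D D
    + 2 * mu5 * dotv (D *m g) (D *m g).
Proof.
have DE : 2^-1 *: (G + G^T) = D by [].
have sD : D^T = D by rewrite /D linearZ/= linearD/= trmxK addrC.
clearbody D; rewrite mxdot_sym; last first.
  rewrite linearD/= linearD/= !linearZ/= linearD/= !trmx_mul !trmxK sD.
  by congr (_ + _ *: _); rewrite addrC.
rewrite DE !(mxdotDl, mxdotZl) !mxdot_outer.
have -> : dotv g (D *m g) = quadform D g.
  by rewrite /dotv /quadform mulmxA.
have -> : dotv g (D *m (D *m g)) = dotv (D *m g) (D *m g).
  by rewrite /dotv trmx_mul sD !mulmxA.
by ring.
Qed.

End linear_algebra.

Section energy_algebra.
Variable R : realType.

(** All differential expressions at a given point are treated as unknowns: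
    [X], [Bw], [Sw], [p1w], [pdw] are the products of the terms of the momentum
    equation with the intermediate velocity, [cu2], [cq] those of the velocity
    difference with the new velocity and with the gradient of the pressure
    increment, [LP] and [Lf] the Laplacians of the new [psi] and of the
    difference [f] of [phi], [dUg] and [dw] the two divergences of the phase
    equation.  The hypotheses are solved for [EU2], [cu2], [LP], [f], [s0] and
    [U0]. *)
Lemma energy_algebra (K M eps dt mu1 mu4 mu5 : R)
  (EU2 EU1 cu2 c33 P s1 s0 Un U1 U0 p2p2 p1p1 p1q qq pd Q D2 DG X Bw Sw p1w ps
   pdw cq qu2 p1u2 f LP Lf dUg gf dw PF : R) :
  K != 0 -> M != 0 -> eps != 0 -> dt != 0 ->
  EU2 - EU1 = 2^-1 * cu2 - 4^-1 * c33 ->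
  (2 * dt)^-1 * X + Bw - Sw + p1w - M^-1 * ps * pdw = 0 ->
  X = cu2 + 2 * dt / 3 * cq + 2 * dt * qu2 + 2 * dt * (2 * dt / 3) * qq ->
  p1w = p1u2 + 2 * dt / 3 * p1q ->
  p2p2 = p1p1 + 2 * p1q + qq ->
  M^-1 * pd = K * LP + K / eps ^+ 2 * dUg ->
  pd = f / (2 * dt) + dw ->
  P *+ 3 - s1 *+ 4 + s0 = - Lf ->
  Un *+ 3 - U1 *+ 4 + U0 = 2 * gf ->
  (EU2 + K / 4 * (P ^+ 2 + (2 * P - s1) ^+ 2)
    + K / (8 * eps ^+ 2) * (Un ^+ 2 + (2 * Un - U1) ^+ 2) + dt ^+ 2 / 3 * p2p2)
  - (EU1 + K / 4 * (s1 ^+ 2 + (2 * s1 - s0) ^+ 2)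
    + K / (8 * eps ^+ 2) * (U1 ^+ 2 + (2 * U1 - U0) ^+ 2) + dt ^+ 2 / 3 * p1p1)
  + (dt / M * pd ^+ 2 + dt * (mu1 * Q ^+ 2 + mu4 * D2 + mu5 * DG)) =
  (- (dt / 3) * cq + (- dt * qu2 + (- dt * p1u2 + (- dt * Bw
    + (dt * (Sw + (mu1 * Q ^+ 2 + mu4 * D2 + 2 * mu5 * DG))
    + (- (K / 2) * (PF + P * Lf) + (K / 2 * (PF + f * LP)
    + (K / (2 * eps ^+ 2) * (Un * gf + f * dUg)
    + dt / M * (ps * pdw + pd * dw)))))))))
  - (4^-1 * c33 + K / 4 * (P - 2 * s1 + s0) ^+ 2
    + K / (8 * eps ^+ 2) * (Un - 2 * U1 + U0) ^+ 2 + dt ^+ 2 / 3 * qq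
    + dt * mu5 * DG).
Proof.
move=> K0 M0 e0 t0 h1 h2 h3 h4 h5 h6 h7 h8 h9.
have -> : EU2 = EU1 + 2^-1 * cu2 - 4^-1 * c33 by rewrite -addrA -h1; ring.
have -> : cu2 = - (2 * dt) * (Bw - Sw + p1w - M^-1 * ps * pdw)
    - 2 * dt / 3 * cq - 2 * dt * qu2 - 2 * dt * (2 * dt / 3) * qq.
  have -> : Bw - Sw + p1w - M^-1 * ps * pdw = - ((2 * dt)^-1 * X).
    by apply/eqP; rewrite -subr_eq0 opprK -h2; apply/eqP; ring.
  by rewrite h3; field.
rewrite h4 h5.
have -> : LP = (M^-1 * pd - K / eps ^+ 2 * dUg) / K by rewrite h6; field; rewrite K0.
have -> : f = 2 * dt * (pd - dw) by rewrite h7; field.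
have -> : s0 = - Lf - P *+ 3 + s1 *+ 4 by rewrite -h8; ring.
have -> : U0 = 2 * gf - Un *+ 3 + U1 *+ 4 by rewrite -h9; ring.
by field; rewrite K0 M0 e0 ?t0.
Qed.

End energy_algebra.

Section integral_on_domain.
Context {R : realType} {d : nat}.
Variables (Omega : set 'rV[R]_d) (m : 'rV[R]_d -> 'cV[R]_d).
Hypotheses (hOmega : bounded_smooth_domain Omega) (hm : outward_normal Omega m).
Local Notation OmegaT := (@row_of_tuple R d @^-1` Omega).
Implicit Types (f g : 'rV[R]_d -> R).

Definition domain_int f : R := \int[lebesgue_Rd d]_(t in OmegaT) f (row_of_tuple t).

Lemma integrable_smooth_bar f : smooth_bar Omega f ->
  (lebesgue_Rd d).-integrable OmegaT (EFin \o (f \o @row_of_tuple R d)).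
Proof.
have [oO _ _ bO _] := hOmega.
by move=> [V [oV OV sf]]; exact: (integrable_domain oO bO OV (sf 0%N)).
Qed.

Lemma domain_intD f g : smooth_bar Omega f -> smooth_bar Omega g ->
  domain_int (fun x => f x + g x) = domain_int f + domain_int g.
Proof.
have [oO _ _ bO _] := hOmega.
by move=> sf sg; rewrite /domain_int -RintegralD//;
  [exact: measurable_domain|exact: integrable_smooth_bar..].
Qed.

Lemma domain_intZ c f : smooth_bar Omega f ->
  domain_int (fun x => c * f x) = c * domain_int f.
Proof.
have [oO _ _ bO _] := hOmega.
by move=> sf; rewrite /domain_int -RintegralZl//;
  [exact: measurable_domain|exact: integrable_smooth_bar].
Qed.

Lemma domain_intB f g : smooth_bar Omega f -> smooth_bar Omega g ->
  domain_int (fun x => f x - g x) = domain_int f - domain_int g.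
Proof.
have [oO _ _ bO _] := hOmega.
by move=> sf sg; rewrite /domain_int -RintegralB//;
  [exact: measurable_domain|exact: integrable_smooth_bar..].
Qed.

Lemma eq_domain_int f g : (forall x, Omega x -> f x = g x) ->
  domain_int f = domain_int g.
Proof. by move=> fg; apply: eq_Rintegral => t /set_mem Ot; exact: fg. Qed.

Lemma domain_int_ge0 f : (forall x, Omega x -> 0 <= f x) -> 0 <= domain_int f.
Proof. by move=> f0; apply: Rintegral_ge0 => t; exact: f0. Qed.

Lemma sqr_L2norm f : L2norm Omega f ^+ 2 = domain_int (fun x => f x ^+ 2).
Proof.
rewrite /L2norm sqr_sqrtr//.
by apply: (@domain_int_ge0 (fun x => f x ^+ 2)) => x _; exact: sqr_ge0.
Qed.

Lemma sqr_L2normM k l (F : 'rV[R]_d -> 'M[R]_(k, l)) :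
  L2normM Omega F ^+ 2 = domain_int (fun x => \sum_i \sum_j F x i j ^+ 2).
Proof.
rewrite /L2normM sqr_L2norm; apply: eq_domain_int => x _; rewrite /frob sqr_sqrtr//.
by apply: sumr_ge0 => i _; apply: sumr_ge0 => j _; exact: sqr_ge0.
Qed.

Lemma sqr_L2normv (F : 'rV[R]_d -> 'cV[R]_d) :
  L2normM Omega F ^+ 2 = domain_int (fun x => dotv (F x) (F x)).
Proof.
rewrite sqr_L2normM; apply: eq_domain_int => x _; rewrite dotvE.
by apply: eq_bigr => i _; rewrite big_ord1.
Qed.

Lemma sqr_L2norm_mx (F : 'rV[R]_d -> 'M[R]_d) :
  L2normM Omega F ^+ 2 = domain_int (fun x => mxdot (F x) (F x)).
Proof. by rewrite sqr_L2normM; apply: eq_domain_int. Qed.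

Definition tangential (F : 'rV[R]_d -> 'cV[R]_d) :=
  smooth_barv Omega F /\ no_flux Omega m F.

Lemma tangentialM f F : smooth_bar Omega f -> tangential F ->
  tangential (fun x => f x *: F x).
Proof.
move=> sf [sF nF]; split; first exact: smooth_barvZ.
by move=> x bx; rewrite dotvZl nF// mulr0.
Qed.

Lemma tangential_wall F : smooth_barv Omega F ->
  (forall x, bdry Omega x -> F x = 0) -> tangential F.
Proof. by move=> sF F0; split=> // x bx; rewrite F0// dotv0l. Qed.

(** Smoothness is included so that sums of such functions can be formed. *)
Definition mean_zero f := smooth_bar Omega f /\ domain_int f = 0.

Lemma mean_zero_div F : tangential F -> mean_zero (div F).
Proof.
move=> [sF nF]; split; first exact: smooth_bar_div.
by rewrite /domain_int /Rintegral (divergence_tangential hOmega hm sF nF).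
Qed.

Lemma mean_zeroD f g : mean_zero f -> mean_zero g -> mean_zero (fun x => f x + g x).
Proof.
move=> [sf f0] [sg g0]; split; first exact: smooth_barD.
by rewrite domain_intD// f0 g0 addr0.
Qed.

Lemma mean_zeroZ c f : mean_zero f -> mean_zero (fun x => c * f x).
Proof.
move=> [sf f0]; split; first exact: smooth_barZ.
by rewrite domain_intZ// f0 mulr0.
Qed.

End integral_on_domain.

(** * The BDF2 scheme *)

Section stencils.
Context {R : realType} {d : nat}.
Variable Omega : set 'rV[R]_d.

Lemma extrapE (v : nat -> 'rV[R]_d -> R) n :
  extrap v n = fun x => 2 * v n x + -1 * v n.-1 x.
Proof. by apply/funext => x; rewrite /extrap mulN1r mulr_natl. Qed.

Lemma bdfE (v : nat -> 'rV[R]_d -> R) n :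
  bdf v n = fun x => 3 * v n.+1 x + (-4 * v n x + v n.-1 x).
Proof. by apply/funext => x; rewrite /bdf; ring. Qed.

Lemma bdfvE (v : nat -> 'rV[R]_d -> 'cV[R]_d) n :
  bdf v n = fun x => 3 *: v n.+1 x + (-4 *: v n x + v n.-1 x).
Proof. by apply/funext => x; rewrite /bdf scaleNr !scaler_nat addrA. Qed.

Lemma extrapvE (v : nat -> 'rV[R]_d -> 'cV[R]_d) n :
  extrap v n = fun x => 2 *: v n x + -1 *: v n.-1 x.
Proof. by apply/funext => x; rewrite /extrap scaleN1r scaler_nat. Qed.

Section smooth.
Variable v : nat -> 'rV[R]_d -> R.
Hypothesis sv : forall j, smooth_bar Omega (v j).

Lemma smooth_bar_extrap n : smooth_bar Omega (extrap v n).
Proof. by rewrite extrapE; apply: smooth_barD; exact: smooth_barZ. Qed.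

Lemma smooth_bar_bdf n : smooth_bar Omega (bdf v n).
Proof.
rewrite bdfE; apply: smooth_barD; first exact: smooth_barZ.
by apply: smooth_barD => //; exact: smooth_barZ.
Qed.

Lemma grad_extrap n x : closure Omega x ->
  grad (extrap v n) x = extrap (fun j => grad (v j)) n x.
Proof.
move=> cx; have s1 := smooth_barZ 2 (sv n); have s2 := smooth_barZ (-1) (sv n.-1).
by rewrite extrapE (gradD s1 s2 cx) !(gradZ _ _ cx)// extrapvE.
Qed.

Lemma grad_bdf n x : closure Omega x ->
  grad (bdf v n) x = bdf (fun j => grad (v j)) n x.
Proof.
move=> cx; have s4 := @smooth_barD _ _ Omega _ _ (smooth_barZ (-4) (sv n)) (sv n.-1).
have s3 := smooth_barZ 3 (sv n.+1).
rewrite bdfE (gradD s3 s4 cx) (gradD (smooth_barZ (-4) (sv n)) (sv n.-1) cx).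
by rewrite !(gradZ _ _ cx)// bdfvE.
Qed.

End smooth.

Lemma divZc c (F : 'rV[R]_d -> 'cV[R]_d) x : smooth_barv Omega F ->
  closure Omega x -> div (fun y => c *: F y) x = c * div F x.
Proof.
move=> sF cx; rewrite (@divZ _ _ Omega (fun=> c))//; last exact: smooth_bar_cst.
rewrite (_ : grad _ x = 0) ?dotv0l ?add0r//.
by apply/colP => i; rewrite !mxE partial_cst.
Qed.

Section smoothv.
Variable v : nat -> 'rV[R]_d -> 'cV[R]_d.
Hypothesis sv : forall j, smooth_barv Omega (v j).

Let sZ c j : smooth_barv Omega (fun x => c *: v j x).
Proof. by apply: smooth_barvZ => //; exact: smooth_bar_cst. Qed.

Lemma smooth_barv_extrap n : smooth_barv Omega (extrap v n).
Proof. by rewrite extrapvE; exact: smooth_barvD. Qed.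

Lemma smooth_barv_bdf n : smooth_barv Omega (bdf v n).
Proof. by rewrite bdfvE; apply: smooth_barvD => //; exact: smooth_barvD. Qed.

Lemma div_bdf n x : closure Omega x ->
  div (bdf v n) x = bdf (fun j => div (v j)) n x.
Proof.
move=> cx; have s4 := smooth_barvD (sZ (-4) n) (sv n.-1).
rewrite bdfvE (divD (sZ 3 n.+1) s4 cx) (divD (sZ (-4) n) (sv n.-1) cx).
by rewrite !divZc// bdfE.
Qed.

Lemma no_flux_bdf m n : (forall j, no_flux Omega m (v j)) ->
  no_flux Omega m (bdf v n).
Proof.
by move=> hv x bx; rewrite bdfvE !dotvDl !dotvZl !hv// !mulr0 !addr0.
Qed.

Lemma no_flux_extrap m n : (forall j, no_flux Omega m (v j)) ->
  no_flux Omega m (extrap v n).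
Proof. by move=> hv x bx; rewrite extrapvE !dotvDl !dotvZl !hv// !mulr0 addr0. Qed.

End smoothv.

Lemma laplacian_bdf (v : nat -> 'rV[R]_d -> R) n x : open Omega ->
  (forall j, smooth_bar Omega (v j)) -> Omega x ->
  laplacian (bdf v n) x = bdf (fun j => laplacian (v j)) n x.
Proof.
move=> oO sv Ox; have cx := subset_closure Ox.
rewrite -(div_bdf (v := fun j => grad (v j)))//; last first.
  by move=> j; exact: smooth_barv_grad.
rewrite /laplacian /div; apply: eq_bigr => i _; apply: near_eq_partial.
apply: (open_near_eq oO) => // y Oy.
by rewrite grad_bdf//; exact: subset_closure.
Qed.

(** Skew-symmetry of the trilinear form: the term with [div a] in [Bform] is
    the one that completes a divergence. *)
Lemma div_skew (a w : 'rV[R]_d -> 'cV[R]_d) x :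
  smooth_barv Omega a -> smooth_barv Omega w -> closure Omega x ->
  div (fun y => (2^-1 * dotv (w y) (w y)) *: a y) x = dotv (Bform a w x) (w x).
Proof.
move=> sa sw cx.
have sww := smooth_bar_dotv sw sw.
rewrite (divZ (smooth_barZ 2^-1 sww) sa cx) (gradZ _ sww cx) dotvZl /Bform dotvDl dotvZl.
have -> : dotv (grad (fun y => dotv (w y) (w y)) x) (a x) =
    2 * dotv (gradv w x *m a x) (w x).
  have E i : grad (fun y => dotv (w y) (w y)) x i 0 =
      2 * \sum_j gradv w x j i * w x j 0.
    rewrite mxE (_ : (fun y => dotv (w y) (w y)) = fun y => \sum_j w y j 0 * w y j 0).
      rewrite partial_sum; last first.
        by move=> j; apply: smooth_bar_differentiable cx; exact: smooth_barM.
      rewrite mulr_sumr; apply: eq_bigr => j _.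
      rewrite (@partialM _ _ i (fun y => w y j 0) (fun y => w y j 0));
        try exact: smooth_bar_differentiable.
      by rewrite [gradv _ _ _ _]mxE; ring.
    by apply/funext => y; rewrite dotvE.
  rewrite !dotvE mulr_sumr.
  under eq_bigr do rewrite E.
  under [RHS]eq_bigr do rewrite mxE mulr_suml mulr_sumr.
  rewrite [RHS]exchange_big/=; apply: eq_bigr => i _.
  rewrite mulr_sumr mulr_suml; apply: eq_bigr => j _; ring.
by field.
Qed.

End stencils.

Section scheme_facts.
Context {R : realType} {d : nat}.
Variables (K M eps mu1 mu4 mu5 dt : R).
Variables (Omega : set 'rV[R]_d) (m : 'rV[R]_d -> 'cV[R]_d).
Variables (phi psi U : nat -> 'rV[R]_d -> R) (u : nat -> 'rV[R]_d -> 'cV[R]_d)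
  (p : nat -> 'rV[R]_d -> R) (ut : nat -> 'rV[R]_d -> 'cV[R]_d).
Hypothesis hscheme : bdf2_scheme K M eps mu1 mu4 mu5 dt Omega m phi psi U u p ut.

Lemma scheme_smooth :
  [/\ forall j, smooth_bar Omega (phi j), forall j, smooth_bar Omega (psi j),
      forall j, smooth_bar Omega (U j), forall j, smooth_barv Omega (u j) &
      forall j, smooth_bar Omega (p j)].
Proof. by split=> j; have [] := bdf2_smooth hscheme j. Qed.

(** The two initial levels and all computed levels satisfy the same
    relations, so the three levels of a stencil can be treated alike. *)
Lemma scheme_invariants j :
  [/\ forall x, Omega x -> psi j x = - laplacian (phi j) x,
      no_flux Omega m (grad (phi j)), no_flux Omega m (grad (psi j)),
      forall x, Omega x -> div (u j) x = 0 & no_flux Omega m (u j)].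
Proof.
case: j => [|[|j]]; first exact: bdf2_init0 hscheme.
  exact: bdf2_init1 hscheme.
have [_ h1 _ _ _ h2 h3] := bdf2_step1 hscheme (ltn0Sn j).
have [_ h4 h5] := bdf2_step2 hscheme (ltn0Sn j).
by split.
Qed.

Definition energy_density k (x : 'rV[R]_d) : R :=
  4^-1 * (dotv (u k x) (u k x)
    + dotv (2 *: u k x - u k.-1 x) (2 *: u k x - u k.-1 x))
  + K / 4 * (psi k x ^+ 2 + (2 * psi k x - psi k.-1 x) ^+ 2)
  + K / (8 * eps ^+ 2) * (U k x ^+ 2 + (2 * U k x - U k.-1 x) ^+ 2)
  + dt ^+ 2 / 3 * dotv (grad (p k) x) (grad (p k) x).

Definition dissipation_density n (x : 'rV[R]_d) : R :=
  dt / M * phidot dt phi ut n x ^+ 2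
  + dt * (mu1 * quadform (symgrad (ut n.+1) x) (grad (extrap phi n) x) ^+ 2
    + mu4 * mxdot (symgrad (ut n.+1) x) (symgrad (ut n.+1) x)
    + mu5 * dotv (symgrad (ut n.+1) x *m grad (extrap phi n) x)
                 (symgrad (ut n.+1) x *m grad (extrap phi n) x)).

(** The numerical dissipation of the scheme, and the second copy of the
    [mu5] dissipation. *)
Definition residual_density n (x : 'rV[R]_d) : R :=
  4^-1 * dotv (u n.+1 x - u n x *+ 2 + u n.-1 x) (u n.+1 x - u n x *+ 2 + u n.-1 x)
  + K / 4 * (psi n.+1 x - 2 * psi n x + psi n.-1 x) ^+ 2
  + K / (8 * eps ^+ 2) * (U n.+1 x - 2 * U n x + U n.-1 x) ^+ 2
  + dt ^+ 2 / 3 * dotv (grad (fun y => p n.+1 y - p n y) x)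
                       (grad (fun y => p n.+1 y - p n y) x)
  + dt * mu5 * dotv (symgrad (ut n.+1) x *m grad (extrap phi n) x)
                    (symgrad (ut n.+1) x *m grad (extrap phi n) x).

(** In this order: the pressure increment against the velocity difference
    and the new velocity, the old pressure, convection, stress, the two terms of
    Green's formula for [psi] and the difference of [phi], the term of [U], and
    the transport of [phi]. *)
Definition energy_flux_div n (x : 'rV[R]_d) : R :=
  let q y := p n.+1 y - p n y in
  let w := ut n.+1 in
  let f := bdf phi n in
  let ps := extrap phi n in
  let g := grad ps in
  - (dt / 3) * div (fun y => q y *: bdf u n y) x
  + (- dt * div (fun y => q y *: u n.+1 y) x
  + (- dt * div (fun y => p n y *: u n.+1 y) x
  + (- dt * div (fun y => (2^-1 * dotv (w y) (w y)) *: extrap u n y) x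
  + (dt * div (fun y => (stress mu1 mu4 mu5 w ps y)^T *m w y) x
  + (- (K / 2) * div (fun y => psi n.+1 y *: grad f y) x
  + (K / 2 * div (fun y => f y *: grad (psi n.+1) y) x
  + (K / (2 * eps ^+ 2) * div (fun y => f y *: (U n.+1 y *: g y)) x
  + dt / M * div (fun y => phidot dt phi ut n y *: (ps y *: w y)) x))))))).

Lemma smooth_bar_phidot n : (1 <= n)%N -> smooth_bar Omega (phidot dt phi ut n).
Proof.
move=> hn; have [sphi _ _ _ _] := scheme_smooth.
have sw := bdf2_smooth_ut hscheme hn.
apply: smooth_barD.
  apply: smooth_barM; last exact: smooth_bar_cst.
  exact: smooth_bar_bdf.
by apply: smooth_bar_div; apply: smooth_barvZ => //; exact: smooth_bar_extrap.
Qed.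

Hypotheses (hOmega : bounded_smooth_domain Omega) (hm : outward_normal Omega m).

(** Each flux is tangential: those with a velocity of the sequence by the
    impermeability condition, those with a gradient by the Neumann conditions,
    and the others because the intermediate velocity vanishes on the boundary. *)
Lemma mean_zero_energy_flux n : (1 <= n)%N -> mean_zero Omega (energy_flux_div n).
Proof.
move=> hn; have [sphi spsi sU su sp] := scheme_smooth.
have sw := bdf2_smooth_ut hscheme hn.
have w0 := step1_ut_bdry (bdf2_step1 hscheme hn).
have sq : smooth_bar Omega (fun y => p n.+1 y - p n y) by exact: smooth_barB.
have spd := smooth_bar_phidot hn.
have sps := smooth_bar_extrap sphi n.
have sf := smooth_bar_bdf sphi n.
have tu j : tangential Omega m (u j).
  by split=> //; have [] := scheme_invariants j.
have tc : tangential Omega m (bdf u n).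
  split; first exact: smooth_barv_bdf.
  by apply: no_flux_bdf => j; have [] := scheme_invariants j.
have tf : tangential Omega m (grad (bdf phi n)).
  split; first exact: smooth_barv_grad.
  move=> x bx; rewrite (grad_bdf sphi n bx.1).
  apply: (no_flux_bdf (v := fun j => grad (phi j))) bx => j.
  by have [] := scheme_invariants j.
have tg : tangential Omega m (grad (extrap phi n)).
  split; first exact: smooth_barv_grad.
  move=> x bx; rewrite (grad_extrap sphi n bx.1).
  apply: (no_flux_extrap (v := fun j => grad (phi j))) bx => j.
  by have [] := scheme_invariants j.
have tpsi : tangential Omega m (grad (psi n.+1)).
  by split; [exact: smooth_barv_grad|have [] := scheme_invariants n.+1].
have tw : tangential Omega m (ut n.+1) by exact: tangential_wall.
have mz c F : tangential Omega m F -> mean_zero Omega (fun x => c * div F x).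
  by move=> tF; apply: (mean_zeroZ hOmega); exact: (mean_zero_div hOmega hm tF).
have mzD c F h : tangential Omega m F -> mean_zero Omega h ->
    mean_zero Omega (fun x => c * div F x + h x).
  by move=> tF zh; apply: (mean_zeroD hOmega) => //; exact: mz.
rewrite /energy_flux_div; cbv zeta.
apply: (mzD); [|apply: (mzD); [|apply: (mzD); [|apply: (mzD); [|apply: (mzD); [|
  apply: (mzD); [|apply: (mzD); [|apply: (mzD); [|apply: mz]]]]]]]].
- exact: tangentialM.
- exact: tangentialM.
- exact: tangentialM.
- apply: tangential_wall => [|x bx]; last by rewrite w0// dotv0l mulr0 scale0r.
  apply: smooth_barvZ; last exact: smooth_barv_extrap.
  by apply: smooth_barZ; exact: smooth_bar_dotv.
- apply: tangential_wall => [|x bx]; last by rewrite w0// mulmx0.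
  apply: smooth_barm_barv; apply: smooth_barm_mul; last exact: smooth_barv_barm.
  by apply: smooth_barm_tr; exact: smooth_barm_stress.
- exact: tangentialM.
- exact: tangentialM.
- by apply: tangentialM => //; exact: tangentialM.
- by apply: tangentialM => //; exact: tangentialM.
Qed.

(** Collects the pointwise equations of the step and the product rules for
    the fluxes, and leaves the elimination to [energy_algebra]. *)
Lemma bdf2_energy_identity n x : K != 0 -> M != 0 -> eps != 0 -> dt != 0 ->
  (1 <= n)%N -> Omega x ->
  energy_density n.+1 x - energy_density n x + dissipation_density n x =
  energy_flux_div n x - residual_density n x.
Proof.
move=> K0 M0 e0 t0 hn Ox; have [sphi spsi sU su sp] := scheme_smooth.
have [oO _ _ _ _] := hOmega.
have cx := subset_closure Ox.
have sw := bdf2_smooth_ut hscheme hn.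
have st1 := bdf2_step1 hscheme hn; have st2 := bdf2_step2 hscheme hn.
have sq : smooth_bar Omega (fun y => p n.+1 y - p n y) by exact: smooth_barB.
have spd := smooth_bar_phidot hn.
have sps := smooth_bar_extrap sphi n.
have sf := smooth_bar_bdf sphi n.
have sg := smooth_barv_grad sps.
have sc := smooth_barv_bdf su n.
have ss := smooth_barm_stress mu1 mu4 mu5 sw sps.
have divu j : div (u j) x = 0 by have [_ _ _ + _] := scheme_invariants j; exact.
pose q y := p n.+1 y - p n y.
have gq : grad (p n.+1) x = grad (p n) x + grad q x.
  rewrite -(gradD (sp n) sq cx); congr (grad _ x).
  by apply/funext => y; rewrite /q addrC subrK.
have hw : ut n.+1 x = u n.+1 x + (2 * dt / 3) *: grad q x.
  have -> : grad q x = - ((3 / (2 * dt)) *: (u n.+1 x - ut n.+1 x)).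
    by apply/eqP; rewrite -addr_eq0 addrC; apply/eqP; exact: step2_u st2 x Ox.
  rewrite scalerN scalerA (_ : 2 * dt / 3 * (3 / (2 * dt)) = 1); last by field.
  by rewrite scale1r opprB addrC subrK.
have dqc : div (fun y => q y *: bdf u n y) x = dotv (grad q x) (bdf u n x).
  rewrite (divZ sq sc cx) (div_bdf su n cx) /bdf !divu.
  by rewrite !mul0rn subr0 addr0 mulr0 addr0.
have dqu : div (fun y => q y *: u n.+1 y) x = dotv (grad q x) (u n.+1 x).
  by rewrite (divZ sq (su n.+1) cx) divu mulr0 addr0.
have dpu : div (fun y => p n y *: u n.+1 y) x = dotv (grad (p n) x) (u n.+1 x).
  by rewrite (divZ (sp n) (su n.+1) cx) divu mulr0 addr0.
have dB := div_skew (smooth_barv_extrap su n) sw cx.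
have dS := div_tr_mul ss sw cx.
have power := stress_power mu1 mu4 mu5 (gradv (ut n.+1) x) (grad (extrap phi n) x).
have dPF := divZ (spsi n.+1) (smooth_barv_grad sf) cx.
have dFP := divZ sf (smooth_barv_grad (spsi n.+1)) cx.
have dFU := divZ sf (smooth_barvZ (sU n.+1) sg) cx.
have dphi := divZ spd (smooth_barvZ sps sw) cx.
rewrite dotvC in dFP; rewrite dotvZr dotvC in dFU; rewrite dotvZr in dphi.
have h1 : 4^-1 * (dotv (u n.+1 x) (u n.+1 x)
      + dotv (2 *: u n.+1 x - u n x) (2 *: u n.+1 x - u n x))
    - 4^-1 * (dotv (u n x) (u n x)
      + dotv (2 *: u n x - u n.-1 x) (2 *: u n x - u n.-1 x)) =
    2^-1 * dotv (bdf u n x) (u n.+1 x) -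
    4^-1 * dotv (u n.+1 x - u n x *+ 2 + u n.-1 x) (u n.+1 x - u n x *+ 2 + u n.-1 x).
  rewrite -mulrBr opprD addrA bdf2_polarization mulrBr mulrA; congr (_ * _ - _).
  by field.
have h2 : (2 * dt)^-1 * dotv (ut n.+1 x *+ 3 - u n x *+ 4 + u n.-1 x) (ut n.+1 x)
    + dotv (Bform (extrap u n) (ut n.+1) x) (ut n.+1 x)
    - dotv (divm (stress mu1 mu4 mu5 (ut n.+1) (extrap phi n)) x) (ut n.+1 x)
    + dotv (grad (p n) x) (ut n.+1 x)
    - M^-1 * extrap phi n x * dotv (grad (phidot dt phi ut n) x) (ut n.+1 x) = 0.
  exact: dotv_momentum (step1_ut st1 Ox).
have h3 : dotv (ut n.+1 x *+ 3 - u n x *+ 4 + u n.-1 x) (ut n.+1 x) =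
    dotv (bdf u n x) (u n.+1 x) + 2 * dt / 3 * dotv (grad q x) (bdf u n x)
    + 2 * dt * dotv (grad q x) (u n.+1 x)
    + 2 * dt * (2 * dt / 3) * dotv (grad q x) (grad q x).
  have -> : ut n.+1 x *+ 3 - u n x *+ 4 + u n.-1 x =
      bdf u n x + (2 * dt) *: grad q x.
    by rewrite hw /bdf; apply/colP => i; rewrite !mxE; field.
  by rewrite hw dotv_projection.
have h4 : dotv (grad (p n) x) (ut n.+1 x) = dotv (grad (p n) x) (u n.+1 x)
    + 2 * dt / 3 * dotv (grad (p n) x) (grad q x).
  by rewrite hw dotvDr dotvZr.
have h5 : dotv (grad (p n.+1) x) (grad (p n.+1) x) =
    dotv (grad (p n) x) (grad (p n) x) + 2 * dotv (grad (p n) x) (grad q x)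
    + dotv (grad q x) (grad q x).
  by rewrite gq !dotvDl !dotvDr (dotvC (grad q x) (grad (p n) x)); ring.
have h6 := step1_phi st1 Ox.
have h8 : psi n.+1 x *+ 3 - psi n x *+ 4 + psi n.-1 x = - laplacian (bdf phi n) x.
  have psiE j : psi j x = - laplacian (phi j) x.
    by have [+ _ _ _ _] := scheme_invariants j; exact.
  rewrite (laplacian_bdf n oO sphi Ox).
  rewrite (psiE n.+1) (psiE n) (psiE n.-1).
  rewrite /bdf; move: (laplacian _ _) (laplacian _ _) (laplacian _ _) => a b c; ring.
have h9 : U n.+1 x *+ 3 - U n x *+ 4 + U n.-1 x =
    2 * dotv (grad (extrap phi n) x) (grad (bdf phi n) x).
  by rewrite (grad_bdf sphi n cx); exact: step1_U st1 x Ox.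
have := energy_algebra mu1 mu4 mu5
  (quadform (symgrad (ut n.+1) x) (grad (extrap phi n) x))
  (mxdot (symgrad (ut n.+1) x) (symgrad (ut n.+1) x))
  (dotv (symgrad (ut n.+1) x *m grad (extrap phi n) x)
        (symgrad (ut n.+1) x *m grad (extrap phi n) x))
  (dotv (grad (psi n.+1) x) (grad (bdf phi n) x))
  K0 M0 e0 t0 h1 h2 h3 h4 h5 h6 erefl h8 h9.
rewrite /energy_flux_div; cbv zeta; rewrite -/q dqc dqu dpu dB dS dPF dFP dFU dphi.
rewrite -power.
exact.
Qed.

Lemma residual_density_ge0 n x : 0 <= K -> 0 <= mu5 -> 0 <= dt ->
  0 <= residual_density n x.
Proof.
move=> K0 m0 t0; have e0 : 0 <= eps ^+ 2 := sqr_ge0 eps.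
have e1 : 0 <= K / (8 * eps ^+ 2) by rewrite divr_ge0// mulr_ge0.
have t1 : 0 <= dt ^+ 2 / 3 by rewrite divr_ge0// sqr_ge0.
rewrite /residual_density; repeat (apply: addr_ge0); apply: mulr_ge0 => //;
  try exact: dotvv_ge0; try exact: sqr_ge0.
- by rewrite divr_ge0.
- exact: mulr_ge0.
Qed.

Lemma energyE k : eps != 0 -> smooth_bar Omega (energy_density k) /\
  energy K eps dt Omega psi U u p k = domain_int Omega (energy_density k).
Proof.
move=> e0; have [sphi spsi sU su sp] := scheme_smooth.
have s2 v : (forall j, smooth_bar Omega (v j)) ->
    smooth_bar Omega (fun x => 2 * v k x - v k.-1 x).
  by move=> sv; apply: smooth_barB => //; exact: smooth_barZ.
have sp2 := s2 _ spsi; have sU2 := s2 _ sU.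
have su2 : smooth_barv Omega (fun x => 2 *: u k x - u k.-1 x).
  have -> : (fun x => 2 *: u k x - u k.-1 x) = extrap u k.
    by apply/funext => x; rewrite /extrap scaler_nat.
  exact: smooth_barv_extrap.
have sg := smooth_barv_grad (sp k).
have q1 := smooth_bar_dotv (su k) (su k); have q2 := smooth_bar_dotv su2 su2.
have q3 := smooth_barX 2 (spsi k); have q4 := smooth_barX 2 sp2.
have q5 := smooth_barX 2 (sU k); have q6 := smooth_barX 2 sU2.
have q7 := smooth_bar_dotv sg sg.
have q12 := smooth_barD q1 q2; have q34 := smooth_barD q3 q4.
have q56 := smooth_barD q5 q6.
have z12 := smooth_barZ 4^-1 q12; have z34 := smooth_barZ (K / 4) q34.
have z56 := smooth_barZ (K / (8 * eps ^+ 2)) q56.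
have z7 := smooth_barZ (dt ^+ 2 / 3) q7.
have a2 := smooth_barD z12 z34; have a3 := smooth_barD a2 z56.
split; first exact: smooth_barD a3 z7.
rewrite /energy; do 3 rewrite sqr_L2normv; do 4 rewrite sqr_L2norm.
rewrite /energy_density.
rewrite (domain_intD hOmega a3 z7) (domain_intD hOmega a2 z56).
rewrite (domain_intD hOmega z12 z34).
rewrite (domain_intZ hOmega _ q12) (domain_intZ hOmega _ q34) (domain_intZ hOmega _ q56).
rewrite (domain_intZ hOmega _ q7).
rewrite (domain_intD hOmega q1 q2) (domain_intD hOmega q3 q4) (domain_intD hOmega q5 q6).
congr (_ + _ + _ + _).
- by move: (domain_int _ _) (domain_int _ _) => a b; field.
- by move: (domain_int _ _) (domain_int _ _) => a b; field.
- by move: (domain_int _ _) (domain_int _ _) => a b; field.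
Qed.

Lemma dissipationE n : (1 <= n)%N ->
  smooth_bar Omega (dissipation_density n) /\
  dt / M * L2norm Omega (phidot dt phi ut n) ^+ 2
    + dt * (mu1 * L2norm Omega (fun x =>
                quadform (symgrad (ut n.+1) x) (grad (extrap phi n) x)) ^+ 2
            + mu4 * L2normM Omega (symgrad (ut n.+1)) ^+ 2
            + mu5 * L2normM Omega (fun x =>
                symgrad (ut n.+1) x *m grad (extrap phi n) x) ^+ 2) =
  domain_int Omega (dissipation_density n).
Proof.
move=> hn; have [sphi _ _ _ _] := scheme_smooth.
have sw := bdf2_smooth_ut hscheme hn.
have sD := smooth_barm_symgrad sw.
have sg := smooth_barv_grad (smooth_bar_extrap sphi n).
have sDg : smooth_barv Omega (fun x => symgrad (ut n.+1) x *m grad (extrap phi n) x).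
  by apply: smooth_barm_barv; apply: smooth_barm_mul => //; exact: smooth_barv_barm.
have q1 := smooth_barX 2 (smooth_bar_phidot hn).
have q2 := smooth_barX 2 (smooth_bar_quadform sD sg).
have q3 : smooth_bar Omega
    (fun x => mxdot (symgrad (ut n.+1) x) (symgrad (ut n.+1) x)).
  by apply: smooth_bar_sum => i; apply: smooth_bar_sum => j; exact: smooth_barM.
have q4 := smooth_bar_dotv sDg sDg.
have z1 := smooth_barZ (dt / M) q1; have z2 := smooth_barZ mu1 q2.
have z3 := smooth_barZ mu4 q3; have z4 := smooth_barZ mu5 q4.
have a23 := smooth_barD z2 z3; have a := smooth_barD a23 z4.
have za := smooth_barZ dt a.
split; first exact: smooth_barD z1 za.
rewrite sqr_L2normv sqr_L2norm_mx; do 2 rewrite sqr_L2norm.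
rewrite /dissipation_density (domain_intD hOmega z1 za) (domain_intZ hOmega _ q1).
rewrite (domain_intZ hOmega _ a) (domain_intD hOmega a23 z4) (domain_intD hOmega z2 z3).
by rewrite (domain_intZ hOmega _ q2) (domain_intZ hOmega _ q3) (domain_intZ hOmega _ q4).
Qed.

End scheme_facts.

Theorem theorem3p4 (R : realType) (d : nat) (hd : d = 2%N \/ d = 3%N)
  (Omega : set 'rV[R]_d) (m : 'rV[R]_d -> 'cV[R]_d)
  (hOmega : bounded_smooth_domain Omega) (hm : outward_normal Omega m)
  (K M eps mu1 mu4 mu5 dt : R)
  (hK : 0 < K) (hM : 0 < M) (heps : 0 < eps)
  (hmu1 : 0 <= mu1) (hmu4 : 0 <= mu4) (hmu5 : 0 <= mu5) (hdt : 0 < dt)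
  (phi psi U : nat -> 'rV[R]_d -> R) (u : nat -> 'rV[R]_d -> 'cV[R]_d)
  (p : nat -> 'rV[R]_d -> R) (ut : nat -> 'rV[R]_d -> 'cV[R]_d)
  (hscheme : bdf2_scheme K M eps mu1 mu4 mu5 dt Omega m phi psi U u p ut)
  (n : nat) (hn : (1 <= n)%N) :
  energy K eps dt Omega psi U u p n.+1 <=
    energy K eps dt Omega psi U u p n
    - dt / M * L2norm Omega (phidot dt phi ut n) ^+ 2
    - dt * (mu1 * L2norm Omega (fun x =>
                quadform (symgrad (ut n.+1) x) (grad (extrap phi n) x)) ^+ 2
            + mu4 * L2normM Omega (symgrad (ut n.+1)) ^+ 2
            + mu5 * L2normM Omega (fun x =>
                symgrad (ut n.+1) x *m grad (extrap phi n) x) ^+ 2).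
Proof.
have K0 : K != 0 by rewrite gt_eqF.
have M0 : M != 0 by rewrite gt_eqF.
have e0 : eps != 0 by rewrite gt_eqF.
have t0 : dt != 0 by rewrite gt_eqF.
have [s2 ->] := energyE hscheme hOmega n.+1 e0.
have [s1 ->] := energyE hscheme hOmega n e0.
have [sD dE] := dissipationE hscheme hOmega hn.
have [sF F0] := mean_zero_energy_flux hscheme hOmega hm hn.
rewrite -addrA -opprD dE.
set e2 := energy_density K eps dt psi U u p n.+1 in s2 *.
set e1 := energy_density K eps dt psi U u p n in s1 *.
set dd := dissipation_density M mu1 mu4 mu5 dt phi ut n in sD *.
set fl := energy_flux_div K M eps mu1 mu4 mu5 dt phi psi U u p ut n in sF F0.
have s21 := smooth_barB s2 s1; have s3 := smooth_barD s21 sD.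
have : 0 <= domain_int Omega (fun x => fl x - (e2 x - e1 x + dd x)).
  rewrite (eq_domain_int (g := residual_density K eps mu5 dt phi psi U u p ut n)).
    by apply: domain_int_ge0 => x _; apply: residual_density_ge0 => //; exact: ltW.
  move=> x Ox; have := bdf2_energy_identity hscheme hOmega K0 M0 e0 t0 hn Ox.
  by rewrite -/e2 -/e1 -/dd -/fl => ->; exact: subKr.
rewrite (domain_intB hOmega sF s3) F0 (domain_intD hOmega s21 sD) (domain_intB hOmega s2 s1).
by rewrite sub0r oppr_ge0 addrAC subr_le0 lerBrDr.
Qed.
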